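(* Let $\mathcal{H}$ be a real Hilbert space, let $d\ge 1$, let $X$ be a closed subset of $\mathbb{R}^d$, and let $L\colon \mathbb{R}[\underline{x}]\otimes B(\mathcal{H})_h\to\mathbb{R}$ be a linear map, where $\mathbb{R}[\underline{x}]=\mathbb{R}[x_1,\ldots,x_d]$. The following are equivalent: (1) There exists a non-negative operator-valued measure $m\colon \operatorname{Bor}(X)\to\mathcal{L}(B(\mathcal{H})_h,\mathbb{R})$ such that $L(F)=\int F\,dm$ for every $F\in\mathbb{R}[\underline{x}]\otimes B(\mathcal{H})_h$. (2) $L(F)\ge 0$ for every $F\in\mathbb{R}[\underline{x}]\otimes B(\mathcal{H})_h$ such that $F(a)\succeq 0$ for every $a\in X$.
   Context: All Hilbert spaces are real. For a Hilbert space $\mathcal{H}$, $B(\mathcal{H})$ is the algebra of bounded linear operators on $\mathcal{H}$, $B(\mathcal{H})_h$ is the real Banach space of self-adjoint ones, and $B(\mathcal{H})_+$ is the set of positive semidefinite ones (written $A\succeq 0$). $\mathcal{L}(B(\mathcal{H})_h,B(\mathcal{K})_h)$ is the Banach space of bounded linear operators from $B(\mathcal{H})_h$ to $B(\mathcal{K})_h$; for $\mathcal{K}=\mathbb{R}$ one identifies $B(\mathcal{K})_h=\mathbb{R}$. $\operatorname{Bor}(X)$ is the Borel $\sigma$-algebra of $X$. Let $\mathcal{P}$ be a $\sigma$-algebra of subsets of a set $X$. A positive operator-valued measure is a set function $E\colon\mathcal{P}\to B(\mathcal{K})_h$ such that: (a) $E(\Delta)\succeq 0$ for all $\Delta\in\mathcal{P}$;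 (b) $E(\Delta_1\cup\Delta_2)=E(\Delta_1)+E(\Delta_2)$ for disjoint $\Delta_1,\Delta_2\in\mathcal{P}$; (c) if $\Delta_i$ is an increasing sequence in $\mathcal{P}$ with union $\Delta\in\mathcal{P}$, then $E(\Delta)=\sup_i E(\Delta_i)$. (For $\mathcal{K}=\mathbb{R}$ this is a finite positive measure.) A non-negative operator-valued measure is a set function $m\colon\mathcal{P}\to\mathcal{L}(B(\mathcal{H})_h,B(\mathcal{K})_h)$ such that for every $A\in B(\mathcal{H})_+$ the set function $m_A\colon\mathcal{P}\to B(\mathcal{K})_h$, $m_A(\Delta)=m(\Delta)(A)$, is a positive operator-valued measure. Integration. For a positive operator-valued measure $E$ and $x\in\mathcal{K}$ let $E_x(\Delta)=\langle E(\Delta)x,x\rangle$. A measurable $f\colon X\to\mathbb{R}$ is $E$-integrable if there is a constant $K_f$ with $\int|f|\,dE_x\le K_f\|x\|^2$ for all $x\in\mathcal{K}$; then $\int f\,dE\in B(\mathcal{K})_h$ is the unique operator with $\langle(\int f\,dE)x,x\rangle=\int f\,dE_x$ for all $x\in\mathcal{K}$. (For $\mathcal{K}=\mathbb{R}$ this is ordinary integrability and the ordinary integral.) Let $\mathcal{I}$ be the space of measurable real functions on $X$ that are $m_A$-integrable for every $A\in B(\mathcal{H})_+$. For $f\in\mathcal{I}$ and $A\in B(\mathcal{H})_h$ put $\int f\,dm_A=\int f\,dm_{A_+}-\int f\,dm_{A_-}$, where $A_+,A_-\in B(\mathcal{H})_+$ are the positive and negative parts of $A$ ($A=A_+-A_-$,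 $A_+A_-=A_-A_+=0$). For $F=\sum_i f_i\otimes A_i\in\mathcal{I}\otimes B(\mathcal{H})_h$ (algebraic tensor product) put $\int F\,dm=\sum_i\int f_i\,dm_{A_i}$. Elements $F=\sum_i p_i\otimes A_i$ of $\mathbb{R}[\underline{x}]\otimes B(\mathcal{H})_h$ are polynomials with coefficients in $B(\mathcal{H})_h$, with values $F(a)=\sum_i p_i(a)A_i$; in $\int F\,dm$ the polynomials $p_i$ are regarded as functions on $X$, and the formula $L(F)=\int F\,dm$ includes the assertion that these functions lie in $\mathcal{I}$. *)

(* Defs.v *)
From HB Require Import structures.
From mathcomp Require Import all_boot all_order all_algebra.
(* The notations of these files clash with those of MathComp-Analysis; the
   homonymous [mcoeff] and [msupp] of the last two are written qualified below. *)
From mathcomp Require Import -(notations) finmap.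
From mathcomp Require Import -(notations) monalg.
From mathcomp Require Import -(notations) mpoly.
From mathcomp Require Import all_classical all_reals all_analysis.

Set Implicit Arguments.
Unset Strict Implicit.
Unset Printing Implicit Defensive.

Import Order.TTheory GRing.Theory Num.Theory.
Import numFieldNormedType.Exports.

Local Open Scope classical_set_scope.
Local Open Scope ring_scope.

HB.mixin Record CompleteNormedModule_isHilbert (R : realType) V
    & CompleteNormedModule R V := {
  inner : {dot V for @idfun R} ;
  inner_norm : forall x : V, inner x x = `|x| ^+ 2
}.

#[short(type="hilbertType")]
HB.structure Definition Hilbert (R : realType) :=
  {V of CompleteNormedModule R V & CompleteNormedModule_isHilbert R V}.

Section SelfAdjoint.
Context (R : realType) (H : hilbertType R).

Definition saop_pred : {pred H -> H} := fun f =>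
  `[< [/\ linear f,
          exists M : R, forall x, `|f x| <= M * `|x|
        & forall x y, inner (f x) y = inner x (f y)] >].

Lemma saop_pred_submod_closed : submod_closed saop_pred.
Proof.
split=> [|a f g /asboolP[linf [M fM] saf] /asboolP[ling [N gN] sag]].
  apply/asboolP; split=> [b x y||x y].
  - by rewrite scaler0 addr0.
  - by exists 0 => x; rewrite mul0r normr0.
  - by rewrite linear0l linear0r.
apply/asboolP; split=> [b x y||x y].
- rewrite !fctE linf ling !scalerDr !scalerA (mulrC b) -!addrA; congr (_ + _).
  by rewrite addrCA.
- exists (`|a| * M + N) => x; rewrite !fctE.
  rewrite (le_trans (ler_normD _ _))// mulrDl lerD// normrZ -mulrA.
  by rewrite ler_wpM2l.
- by rewrite !fctE linearDl linearZl_LR linearDr linearZr_LR /= -saf -sag.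
Qed.

HB.instance Definition _ :=
  GRing.isSubmodClosed.Build R (H -> H) saop_pred saop_pred_submod_closed.

(* The real vector space B(H)_h *)
Record saop := SAOp { saop_fun :> H -> H ; _ : saop_fun \in saop_pred }.

HB.instance Definition _ := [isSub for saop_fun].
HB.instance Definition _ := [Choice of saop by <:].
HB.instance Definition _ := [SubChoice_isSubLmodule of saop by <:].

Definition opnorm (A : saop) : R := sup [set `|A x| | x in [set x | `|x| <= 1]].

Definition psd (A : saop) : Prop := forall x, 0 <= inner (A x) x.

Definition posneg_parts (A : saop) (PN : saop * saop) : Prop :=
  [/\ psd PN.1, psd PN.2, A = PN.1 - PN.2,
      forall x, PN.1 (PN.2 x) = 0 & forall x, PN.2 (PN.1 x) = 0].

(* The pair [posneg_parts] describes exists and is unique by the functional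
   calculus, so the default value of [xget] plays no role. *)
Definition pospart (A : saop) : saop := (xget (0, 0) (posneg_parts A)).1.
Definition negpart (A : saop) : saop := (xget (0, 0) (posneg_parts A)).2.

(* The elements of L(B(H)_h, R) *)
Record bounded_functional := BoundedFunctional {
  functional_fun :> {scalar saop} ;
  _ : exists M : R, forall A, `|functional_fun A| <= M * opnorm A }.

End SelfAdjoint.
Arguments saop {R} H.
Arguments bounded_functional {R} H.

(* The tensor product R[x_1, ..., x_d] (x) B(H)_h, as the space of finitely
   supported families of coefficients in B(H)_h indexed by monomials. *)
Definition oppoly (R : realType) (d : nat) (H : hilbertType R) : Type :=
  malg (Choice.clone (multinom d) _) (GRing.Zmodule.clone (saop H) _).

HB.instance Definition _ (R : realType) (d : nat) (H : hilbertType R) :=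
  GRing.Zmodule.on (oppoly d H).

HB.lock Definition oppoly_scale (R : realType) (d : nat) (H : hilbertType R)
    (c : R) (F : oppoly d H) : oppoly d H :=
  \sum_(k <- monalg.msupp F) mkmalgU k (c *: monalg.mcoeff k F).

Section OppolyLmodule.
Context (R : realType) (d : nat) (H : hilbertType R).
Implicit Types F G : oppoly d H.

Lemma mcoeff_oppoly_scale (c : R) F k :
  monalg.mcoeff k (oppoly_scale c F) = c *: monalg.mcoeff k F.
Proof.
rewrite oppoly_scale.unlock raddf_sum /=.
under eq_bigr do rewrite mcoeffU.
have [kF|kF] := boolP (k \in monalg.msupp F).
  rewrite (bigD1_seq k) ?fset_uniq//= eqxx mulr1n big1 ?addr0// => j /negPf jk.
  by rewrite jk.
rewrite mcoeff_outdom// scaler0 big_seq big1// => j jF.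
by case: eqVneq => // jk; rewrite -jk jF in kF.
Qed.

Lemma oppoly_scaleA (a b : R) F :
  oppoly_scale a (oppoly_scale b F) = oppoly_scale (a * b) F.
Proof. by apply/malgP => k; rewrite !mcoeff_oppoly_scale scalerA. Qed.

Lemma oppoly_scale1 : left_id (1 : R) (@oppoly_scale R d H).
Proof. by move=> F; apply/malgP => k; rewrite mcoeff_oppoly_scale scale1r. Qed.

Lemma oppoly_scaleDr : right_distributive (@oppoly_scale R d H) +%R.
Proof.
move=> c F G; apply/malgP => k.
by rewrite !(mcoeff_oppoly_scale, monalg.mcoeffD) scalerDr.
Qed.

Lemma oppoly_scaleDl F : {morph (@oppoly_scale R d H)^~ F : a b / a + b}.
Proof.
move=> a b; apply/malgP => k.
by rewrite monalg.mcoeffD !mcoeff_oppoly_scale scalerDl.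
Qed.

HB.instance Definition _ := GRing.Zmodule_isLmodule.Build R (oppoly d H)
  oppoly_scaleA oppoly_scale1 oppoly_scaleDr oppoly_scaleDl.

Lemma mcoeff_oppolyZ (c : R) F k :
  monalg.mcoeff k (c *: F) = c *: monalg.mcoeff k F.
Proof. exact: mcoeff_oppoly_scale. Qed.

End OppolyLmodule.

(* The elementary tensor p (x) A *)
HB.lock Definition tensor (R : realType) (d : nat) (H : hilbertType R)
    (p : mpoly d R) (A : saop H) : oppoly d H :=
  \sum_(k <- mpoly.msupp p) mkmalgU k (mpoly.mcoeff k p *: A).

Definition poly_fun (R : realType) (d : nat) (p : mpoly d R) (a : 'rV[R]_d) : R :=
  meval (fun i => a ord0 i) p.

HB.lock Definition oppoly_eval (R : realType) (d : nat) (H : hilbertType R)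
    (F : oppoly d H) (a : 'rV[R]_d) : saop H :=
  \sum_(k <- monalg.msupp F) poly_fun (mpolyX R k) a *: monalg.mcoeff k F.

Section OppolyTheory.
Context (R : realType) (d : nat) (H : hilbertType R).
Implicit Types (F G : oppoly d H) (A : saop H) (p : mpoly d R).

Lemma mcoeff_tensor p A k :
  monalg.mcoeff k (tensor p A) = mpoly.mcoeff k p *: A.
Proof.
rewrite tensor.unlock raddf_sum /=.
under eq_bigr do rewrite mcoeffU.
have [kp|kp] := boolP (k \in mpoly.msupp p).
  rewrite (bigD1_seq k) ?msupp_uniq//= eqxx mulr1n big1 ?addr0// => j /negPf jk.
  by rewrite jk.
rewrite memN_msupp_eq0// scale0r big_seq big1// => j jp.
by case: eqVneq => // jk; rewrite -jk jp in kp.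
Qed.

Lemma oppolyE F :
  F = \sum_(k <- monalg.msupp F) tensor (mpolyX R k) (monalg.mcoeff k F).
Proof.
rewrite [LHS]monalgE; apply: eq_bigr => k _.
by rewrite tensor.unlock msuppX big_seq1 mcoeffX eqxx scale1r.
Qed.

Lemma oppoly_evalEw F a (r : finSet (multinom d)) :
  fsubset (monalg.msupp F) r ->
  oppoly_eval F a = \sum_(k <- r) poly_fun (mpolyX R k) a *: monalg.mcoeff k F.
Proof.
move=> Fr; rewrite oppoly_eval.unlock; apply: big_fset_incl => // k _ kF.
by rewrite mcoeff_outdom// scaler0.
Qed.

Lemma oppoly_evalD F G a : oppoly_eval (F + G) a = oppoly_eval F a + oppoly_eval G a.
Proof.
pose r := fsetU (monalg.msupp F) (monalg.msupp G).
rewrite !(@oppoly_evalEw _ _ r) ?fsubsetUl ?fsubsetUr ?monalg.msuppD_le//.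
by rewrite -big_split/=; apply: eq_bigr => k _; rewrite monalg.mcoeffD scalerDr.
Qed.

Lemma oppoly_eval_tensor p A a : oppoly_eval (tensor p A) a = poly_fun p a *: A.
Proof.
rewrite (@oppoly_evalEw _ _ (seq_fset tt (mpoly.msupp p))); last first.
  apply/fsubsetP => k; rewrite -monalg.mcoeff_neq0 mcoeff_tensor seq_fsetE.
  by apply: contraR => kp; rewrite memN_msupp_eq0// scale0r.
rewrite (perm_big (mpoly.msupp p)) /=; last first.
  by apply: uniq_perm; [exact: sort_keys_uniq|exact: msupp_uniq|exact: sort_keysE].
rewrite /poly_fun mevalE scaler_suml; apply: eq_bigr => k _.
by rewrite mcoeff_tensor mevalX scalerA mulrC.
Qed.

End OppolyTheory.

(* R^d with its Borel sigma-algebra *)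
Definition borelRd (R : realType) (d : nat) :=
  g_sigma_algebraType (@open 'rV[R]_d).

Section OperatorMeasures.
Context (R : realType) (H : hilbertType R).
Context (disp : measure_display) (T : measurableType disp) (X : set T).
Implicit Types (f : T -> R) (A : saop H).

(* The trace sigma-algebra when X is measurable; for X closed in R^d it is Bor(X),
   see [closed_sigma_onE]. *)
Definition sigma_on : set (set T) := [set D | measurable D /\ D `<=` X].

(* The positive operator-valued measures on X for a one-dimensional K *)
Definition positive_measure (E : set T -> R) : Prop :=
  [/\ forall D, sigma_on D -> 0 <= E D,
      forall D1 D2, sigma_on D1 -> sigma_on D2 -> D1 `&` D2 = set0 ->
        E (D1 `|` D2) = E D1 + E D2
    & forall D : nat -> set T, (forall i, sigma_on (D i)) ->
        (forall i, D i `<=` D i.+1) ->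
        E (\bigcup_i D i) = sup [set E (D i) | i in [set: nat]]].

(* The values of m outside [sigma_on] are irrelevant. *)
Definition nonneg_opmeasure (m : set T -> bounded_functional H) : Prop :=
  forall A, psd A -> positive_measure (fun D => m D A).

Variable m : set T -> bounded_functional H.

(* m_A, extended by 0 outside X to a set function on the measurable sets of T so
   that the integral of the library applies *)
Definition opmeasure_at A (D : set T) : \bar R := (m (D `&` X) A)%:E.

(* f belongs to the space of functions that are m_A-integrable for all A >= 0 *)
Definition opintegrable f : Prop :=
  forall A, psd A -> (opmeasure_at A).-integrable X (EFin \o f).

Definition opintegral_psd f A : R :=
  fine (\int[opmeasure_at A]_(x in X) (f x)%:E)%E.

Definition opintegral f A : R :=
  opintegral_psd f (pospart A) - opintegral_psd f (negpart A).

End OperatorMeasures.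

Lemma closed_measurable (R : realType) (d : nat) (X : set (borelRd R d)) :
  closed (X : set 'rV[R]_d) -> measurable X.
Proof.
move=> cX; rewrite -[X]setCK; apply: measurableC.
by apply: sub_sigma_algebra; exact: closed_openC.
Qed.

Lemma closed_sigma_onE (R : realType) (d : nat) (X : set (borelRd R d)) :
  closed (X : set 'rV[R]_d) ->
  sigma_on X = <<s X, [set X `&` U | U in [set U : set 'rV[R]_d | open U]] >>.
Proof.
move=> cX; pose S := <<s X, [set X `&` U | U in [set U : set 'rV[R]_d | open U]] >>.
apply/seteqP; split => D => [[mD DX]|].
  suff /(_ _ mD) : @measurable _ (borelRd R d) `<=` [set D | S (X `&` D)].
    by rewrite /= setIidr.
  apply: smallest_sub => [|U oU /=]; last by apply: sub_sigma_algebra; exists U.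
  split=> /= [|A SA|A SA].
  - by rewrite setI0; exact: sigma_algebra0.
  - suff -> : X `&` (setT `\` A) = X `\` (X `&` A) by exact: sigma_algebraCD.
    by rewrite setTD -setDE setDIr setDv set0U.
  - by rewrite setI_bigcupr; exact: sigma_algebra_bigcup.
move: D; apply: smallest_sub => [|_ [U oU <-]].
- split=> [|A [mA AX]|A SA].
  + by split=> //; exact: measurable0.
  + by split; [apply: measurableD => //; exact: closed_measurable|exact: subDsetl].
  + split; first by apply: bigcup_measurable => k _; have [] := SA k.
    by apply: bigcup_sub => k _; have [] := SA k.
- split=> //; apply: measurableI; first exact: closed_measurable.
  exact: sub_sigma_algebra.
Qed.

(* Main.v *)
Require Import Defs.
From HB Require Import structures.
From mathcomp Require Import all_boot all_order all_algebra.
From mathcomp Require Import -(notations) finmap.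
From mathcomp Require Import -(notations) monalg.
From mathcomp Require Import -(notations) mpoly.
From mathcomp Require Import all_classical all_reals all_analysis.
From mathcomp Require Import measurable_realfun.
From mathcomp Require Import ring lra.

(** From the measure to positivity. Monomials are differences of squares, so [F]
    is a sum of tensors [f_i (x) A_i] with [f_i >= 0] ([oppoly_squares]). If [D] is
    a Borel subset of [X] on which every [f_i] varies by at most [e], and [a] is a
    point of [D], then the sum of the integrals of [f_i] over [D] against
    [m_(A_i)] differs from [m D (F a)], which is nonnegative, by at most [e] times
    a finite total mass. Countably many such sets [D] partition [X], and [e] is
    arbitrary ([compare_integrals]).

    From positivity to the measure. For one fixed positive [A] this is the moment
    problem for the functional [p |-> L (p (x) A)]; its solution need not be
    unique, and the point is to choose the solutions so that they depend linearly
    on [A]. Therefore the choice is made once for all [A]: by M. Riesz's extension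
    theorem ([riesz_extension]), [L] extends to a positive linear form on all
    functions from [X] to B(H)_h that polynomials dominate. Its values [n S A] at
    the step functions [1_S (x) A] are linear in [A] and finitely additive in [S]
    ([positive_extension]).

    For positive [A], the set function [S |-> n S A] is made countably additive by
    approximation from inside with compact sets and then from outside with open
    sets, together with Caratheodory's construction ([outer_content_measure]).
    This procedure involves no choice, and it is linear in [A] because the compact
    subsets of an open set, and the open sets containing a given set, are directed
    ([outer_content_comb]). Decomposing operators into positive and negative
    parts, which exist by a square root construction ([posneg_parts_exist]),
    extends the measures from the positive cone to B(H)_h ([cone_functional]).

    The measure [mu] obtained from [S |-> n S A] is at most [n] on open sets. It has
    the same total mass, because [|x|^2] is a polynomial and so little of [n] lies
    far out ([content_tight]); hence [mu] is at least [n] on closed sets. Both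
    bounds apply to the level sets of a polynomial [f >= 0], and a comparison of
    [f] with the step functions [\sum_(k < K) h 1_{f >= k h}] gives
    [\int f dmu = L (f (x) A)]; what is lost above the height [K h] is at most
    [f^2 / (K h)], whose value under [L] tends to 0 as [K] grows
    ([integral_outer_content]). *)

Set Implicit Arguments.
Unset Strict Implicit.
Unset Printing Implicit Defensive.

Import Order.TTheory GRing.Theory Num.Theory.
Import numFieldNormedType.Exports.

Local Open Scope classical_set_scope.
Local Open Scope ring_scope.

(** * Extension of positive functionals *)

Section Sublinear.
Context (R : realType) (V : lmodType R).
Implicit Types (q : V -> R) (x y a : V).

Definition sublinear q :=
  (forall x y, q (x + y) <= q x + q y) /\
  (forall (t : R) x, 0 <= t -> q (t *: x) <= t * q x).

Lemma sublinear0 q : sublinear q -> q 0 = 0.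
Proof.
move=> [qD qZ]; apply/le_anti/andP; split.
  by have := qZ 0 0 (lexx 0); rewrite scaler0 mul0r.
by have := qD 0 0; rewrite addr0; lra.
Qed.

Lemma sublinearN q x : sublinear q -> - q (- x) <= q x.
Proof.
by move=> sq; have := sq.1 x (- x); rewrite subrr sublinear0//; lra.
Qed.

Lemma sublinearZ q (t : R) x : sublinear q -> 0 <= t -> q (t *: x) = t * q x.
Proof.
move=> sq; rewrite le_eqVlt => /predU1P[<-|t0].
  by rewrite scale0r sublinear0// mul0r.
apply/le_anti/andP; split; first exact: sq.2 (ltW t0).
have := sq.2 t^-1 (t *: x); rewrite scalerA mulVf ?gt_eqF// scale1r invr_ge0.
move=> /(_ (ltW t0)); rewrite -(ler_pM2l t0) mulrA mulfV ?gt_eqF//.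
by rewrite mul1r.
Qed.

(** Directedness is what makes the infimum subadditive: [q x] and [r y] are
    bounded from below by values of a common [s]. *)
Lemma sublinear_inf (Q : set (V -> R)) (b : V -> R) : Q !=set0 ->
  (forall q, Q q -> sublinear q) -> (forall q x, Q q -> b x <= q x) ->
  (forall q r, Q q -> Q r -> exists2 s, Q s & forall x, s x <= q x /\ s x <= r x) ->
  sublinear (fun x => inf [set q x | q in Q]).
Proof.
move=> [q0 Q0] Qs Qb Qd.
have hi x : has_inf [set q x | q in Q].
  split; first by exists (q0 x), q0.
  by exists (b x) => _ [q /Qb + <-]; exact.
have infle x q : Q q -> inf [set q x | q in Q] <= q x.
  by move=> Qq; apply: ge_inf; [exact: (hi x).2|exists q].
split=> [x y|t x] /=.
- rewrite -lerBlDr; apply: (lb_le_inf (hi x).1).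
  move=> _ [q Qq <-]; rewrite lerBlDr -lerBlDl.
  apply: (lb_le_inf (hi y).1).
  move=> _ [r Qr <-]; have [s Qs' sqr] := Qd _ _ Qq Qr.
  have := infle (x + y) _ Qs'; have := (Qs _ Qs').1 x y.
  by have [] := sqr x; have [] := sqr y; lra.
- rewrite le_eqVlt => /predU1P[<-|t0].
    rewrite scale0r mul0r; apply: le_trans (infle _ _ Q0) _.
    by rewrite sublinear0//; exact: Qs.
  rewrite mulrC -ler_pdivrMr//; apply: (lb_le_inf (hi x).1).
  move=> _ [q Qq <-]; rewrite ler_pdivrMr// mulrC -sublinearZ ?(ltW t0)//.
    exact: infle.
  exact: Qs.
Qed.

(** For every [a], the functional [r x = inf_(t >= 0) (q (x + t a) - t q a)] is
    sublinear and at most [q], so it equals [q]; taking [t = 1] gives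
    [q x + q a <= q (x + a)]. *)
Lemma minimal_sublinear_linear q : sublinear q ->
  (forall r, sublinear r -> (forall x, r x <= q x) -> forall x, q x <= r x) ->
  linear_for *%R q.
Proof.
move=> sq qmin.
have qDge x a : q x + q a <= q (x + a).
  pose r x := inf [set q (x + t *: a) - t * q a | t in [set t | 0 <= t]].
  have lbr y t : 0 <= t -> - q (- y) <= q (y + t *: a) - t * q a.
    move=> t0; have := sq.1 (- y) (y + t *: a).
    by rewrite addKr sublinearZ//; lra.
  have hi y : has_inf [set q (y + t *: a) - t * q a | t in [set t | 0 <= t]].
    split; first by exists (q (y + 0 *: a) - 0 * q a), 0 => //=.
    by exists (- q (- y)) => _ [t t0 <-]; exact: lbr.
  have rle y t : 0 <= t -> r y <= q (y + t *: a) - t * q a.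
    by move=> t0; apply: ge_inf; [exact: (hi y).2|exists t].
  have sr : sublinear r.
    split=> [y z|s y] /=.
    - rewrite -lerBlDr; apply: (lb_le_inf (hi y).1).
      move=> _ [t t0 <-]; rewrite lerBlDr -lerBlDl.
      apply: (lb_le_inf (hi z).1).
      move=> _ [u u0 <-]; have := rle (y + z) (t + u) (addr_ge0 t0 u0).
      have := sq.1 (y + t *: a) (z + u *: a).
      by rewrite addrACA -scalerDl; lra.
    - rewrite le_eqVlt => /predU1P[<-|s0].
        rewrite scale0r mul0r; apply: le_trans (rle _ _ (lexx 0)) _.
        by rewrite scale0r addr0 sublinear0// mul0r subr0.
      rewrite mulrC -ler_pdivrMr//; apply: (lb_le_inf (hi y).1).
      move=> _ [t t0 <-]; rewrite ler_pdivrMr// mulrC mulrBr.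
      rewrite -sublinearZ ?(ltW s0)// scalerDr scalerA mulrA.
      by apply: rle; rewrite mulr_ge0// ltW.
  have rq y : r y <= q y.
    by have := rle y 0 (lexx 0); rewrite scale0r addr0 mul0r subr0.
  have := qmin _ sr rq x; have := rle x 1 ler01; rewrite scale1r mul1r; lra.
have qD x a : q (x + a) = q x + q a.
  by apply/le_anti/andP; split; [exact: sq.1|exact: qDge].
have qN x : q (- x) = - q x.
  by apply/eqP; rewrite -addr_eq0 -qD addNr sublinear0.
move=> t x y; rewrite qD; congr (_ + _).
have [t0|t0] := leP 0 t; first exact: (sublinearZ x sq t0).
by rewrite -[t]opprK scaleNr qN (sublinearZ _ sq) ?oppr_ge0 ?ltW// !mulNr.
Qed.

(** Zorn's lemma provides a minimal sublinear functional below [p]; chains have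
    lower bounds because [- p (- x)] bounds all these functionals from below. *)
Lemma hahn_banach (p : V -> R) : sublinear p ->
  exists f : {scalar V}, forall x, f x <= p x.
Proof.
move=> sp; pose T := {q : V -> R | sublinear q /\ forall x, q x <= p x}.
pose mkT q (sq : sublinear q) (qp : forall x, q x <= p x) : T := exist _ q (conj sq qp).
pose rle (q r : T) := `[< forall x, sval r x <= sval q x >].
have [| | |[q [sq qp]] qmax] := @ZL_preorder T (mkT p sp (fun=> lexx _)) rle.
- by move=> q; apply/asboolP.
- by move=> q r s /asboolP qr /asboolP rs; apply/asboolP => x; exact: le_trans (qr x).
- move=> A Atot; have [A0|/set0P[q0 Aq0]] := eqVneq A set0.
    by exists (mkT p sp (fun=> lexx _)) => s; rewrite A0.
  pose Q : set (V -> R) := [set sval q | q in A].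
  have lbQ q x : Q q -> - p (- x) <= q x.
    move=> [[r [sr rp]] Ar <-] /=; apply: le_trans (sublinearN x sr).
    by rewrite lerN2.
  have sQ : sublinear (fun x => inf [set q x | q in Q]).
    apply: (sublinear_inf (b := fun x => - p (- x))) => //.
    - by exists (sval q0), q0.
    - by move=> _ [[r []]] /= ? ? _ <-.
    - move=> _ _ [q Aq <-] [r Ar <-].
      have [/asboolP qr|/asboolP rq] := Atot _ _ Aq Ar.
        by exists (sval r); [exists r|move=> x; split].
      by exists (sval q); [exists q|move=> x; split].
  have lQ x (q : T) : A q -> inf [set q x | q in Q] <= sval q x.
    move=> Aq; apply: ge_inf; first by exists (- p (- x)) => _ [r /lbQ + <-]; exact.
    by exists (sval q) => //; exists q.
  have Qp x : inf [set q x | q in Q] <= p x.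
    by apply: le_trans (lQ x _ Aq0) _; case: (svalP q0).
  by exists (mkT _ sQ Qp) => s As; apply/asboolP => x; exact: lQ.
have ql : linear_for *%R q.
  apply: minimal_sublinear_linear => // r sr rq.
  have rp x : r x <= p x by exact: le_trans (qp x).
  have := qmax (mkT r sr rp); rewrite /rle/= => H.
  by apply/asboolP/H/asboolP.
pose qL := GRing.isLinear.Build _ _ _ _ q ql.
by pose f : {scalar V} := HB.pack q qL; exists f.
Qed.

End Sublinear.

(** The sublinear functional [inf {L w | phi w - e \in C}] agrees with [L] on the
    image of [phi] and is nonpositive on [- C], so that any linear functional below
    it is an extension of the required kind. *)
Lemma riesz_extension (R : realType) (W E : lmodType R) (phi : {linear W -> E})
    (C : set E) (L : {scalar W}) :
  (forall x y, C x -> C y -> C (x + y)) ->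
  (forall (t : R) x, 0 <= t -> C x -> C (t *: x)) ->
  (forall e, exists w, C (phi w - e)) ->
  (forall w, C (phi w) -> 0 <= L w) ->
  exists f : {scalar E},
    (forall w, f (phi w) = L w) /\ (forall e, C e -> 0 <= f e).
Proof.
move=> CD CZ cof Lpos; pose p e := inf [set L w | w in [set w | C (phi w - e)]].
have C0 : C 0 by have [w Cw] := cof 0; rewrite -(scale0r (phi w - 0)); exact: CZ.
have hi e : has_inf [set L w | w in [set w | C (phi w - e)]].
  split; first by have [w Cw] := cof e; exists (L w), w.
  have [w' Cw'] := cof (- e); exists (- L w') => _ [w /= Cw <-].
  rewrite -subr_ge0 opprK -linearD; apply: Lpos.
  by have := CD _ _ Cw Cw'; rewrite opprK addrACA addNr addr0 linearD.
have ple e w : C (phi w - e) -> p e <= L w.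
  by move=> Cw; apply: ge_inf; [exact: (hi e).2|exists w].
have sp : sublinear p.
  split=> [x y|t x].
  - rewrite -lerBlDr; apply: (lb_le_inf (hi x).1).
    move=> _ [w /= Cw <-]; rewrite lerBlDr -lerBlDl.
    apply: (lb_le_inf (hi y).1).
    move=> _ [v /= Cv <-]; rewrite lerBlDr -linearD; apply: ple.
    by rewrite linearD opprD [phi v + _]addrC addrACA; exact: CD.
  - move=> tge0; have [->|tn0] := eqVneq t 0.
      rewrite scale0r mul0r -(linear0 L); apply: ple.
      by rewrite linear0 subr0.
    have t0 : 0 < t by rewrite lt_neqAle eq_sym tn0.
    rewrite mulrC -ler_pdivrMr//; apply: (lb_le_inf (hi x).1).
    move=> _ [w /= Cw <-]; rewrite ler_pdivrMr// mulrC.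
    have <- : L (t *: w) = t * L w by exact: linearZ.
    apply: ple.
    by rewrite linearZ -scalerBr; apply: CZ => //; exact: ltW.
have [f fp] := hahn_banach sp; exists f.
have fle w : f (phi w) <= L w.
  by apply: le_trans (fp _) _; apply: ple; rewrite subrr.
split=> [w|e Ce].
  apply/le_anti; rewrite fle/= -lerN2.
  by have := fle (- w); rewrite !linearN.
rewrite -oppr_le0 -linearN (le_trans (fp _))// -(linear0 L); apply: ple.
by rewrite linear0 sub0r opprK.
Qed.

(** * Self-adjoint operators *)

Section Operators.
Context (R : realType) (H : hilbertType R).
Implicit Types (x y z : H) (A B C D P N : saop H).

Lemma innerC x y : inner x y = inner y x.
Proof. by rewrite hermC expr0 mul1r. Qed.

Lemma innerDl x y z : inner (x + y) z = inner x z + inner y z.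
Proof. exact: linearDl. Qed.

Lemma innerZl (a : R) x z : inner (a *: x) z = a * inner x z.
Proof. by rewrite linearZl_LR. Qed.

Lemma innerDr x y z : inner z (x + y) = inner z x + inner z y.
Proof. exact: linearDr. Qed.

Lemma innerZr (a : R) x z : inner z (a *: x) = a * inner z x.
Proof. by rewrite innerC innerZl innerC. Qed.

Lemma innerNl x z : inner (- x) z = - inner x z.
Proof. by rewrite -scaleN1r innerZl mulN1r. Qed.

Lemma innerNr x z : inner z (- x) = - inner z x.
Proof. by rewrite -scaleN1r innerZr mulN1r. Qed.

Definition innerE := (innerDl, innerDr, innerNl, innerNr, innerZl, innerZr).

Lemma cauchy_schwarz x y : `|inner x y| <= `|x| * `|y|.
Proof.
have [->|y0] := eqVneq y 0.
  by rewrite -(scale0r (0 : H)) innerZr mul0r scale0r !normr0 mulr0.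
have yy0 : 0 < inner y y by rewrite inner_norm exprn_gt0// normr_gt0.
have : 0 <= inner (inner y y *: x - inner x y *: y)
                  (inner y y *: x - inner x y *: y).
  by rewrite inner_norm sqr_ge0.
rewrite !innerE (innerC y x) => h.
have {h} : 0 <= inner y y * (inner x x * inner y y - inner x y ^+ 2).
  by apply: le_trans h _; rewrite le_eqVlt; apply/orP; left; apply/eqP; ring.
rewrite pmulr_rge0// subr_ge0 !inner_norm -exprMn => h.
by rewrite -(ler_pXn2r (n := 2))// ?nnegrE ?mulr_ge0// real_normK ?num_real.
Qed.

Lemma saopP A : [/\ linear A, exists M : R, forall x, `|A x| <= M * `|x|
        & forall x y, inner (A x) y = inner x (A y)].
Proof. exact/asboolP/(valP A). Qed.

Lemma saop_comm A x y : inner (A x) y = inner x (A y).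
Proof. by have [_ _] := saopP A. Qed.

HB.instance Definition _ A :=
  GRing.isLinear.Build R H H _ (saop_fun A) (let: And3 l _ _ := saopP A in l).

Lemma saopE A B x : (A + B) x = A x + B x. Proof. by []. Qed.
Lemma saopN A x : (- A) x = - A x. Proof. by []. Qed.
Lemma saopZ (a : R) A x : (a *: A) x = a *: A x. Proof. by []. Qed.
Lemma saop0 x : (0 : saop H) x = 0. Proof. by []. Qed.

Lemma saop_linD A x y : A (x + y) = A x + A y. Proof. exact: linearD. Qed.
Lemma saop_linN A x : A (- x) = - A x. Proof. exact: linearN. Qed.
Lemma saop_linZ (a : R) A x : A (a *: x) = a *: A x. Proof. exact: linearZ. Qed.
Lemma saop_lin0 A : A 0 = 0. Proof. exact: linear0. Qed.

Definition saop_lin := (saop_linD, saop_linN, saop_linZ, saop_lin0).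

Definition saopDE := (saopE, saopN, saopZ, saop0).

Lemma psdD A B : psd A -> psd B -> psd (A + B).
Proof. by move=> a b x; rewrite saopE innerDl addr_ge0. Qed.

Lemma psdZ (t : R) A : 0 <= t -> psd A -> psd (t *: A).
Proof. by move=> t0 a x; rewrite saopZ innerZl mulr_ge0. Qed.

Lemma psd0 : psd (0 : saop H).
Proof. by move=> x; rewrite saop0 -(scale0r (0 : H)) innerZl mul0r. Qed.

Lemma idop_subproof : (id : H -> H) \in @saop_pred R H.
Proof. by apply/asboolP; split=> // ; exists 1 => x; rewrite mul1r. Qed.

Definition idop : saop H := SAOp idop_subproof.

Lemma opnorm_ge0 A : 0 <= opnorm A.
Proof.
have [_ [M AM] _] := saopP A.
apply: sup_upper_bound; last by exists 0; rewrite /= ?normr0// saop_lin0 normr0.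
split; first by exists `|A 0|, 0 => //=; rewrite normr0.
exists `|M| => _ [x /= x1 <-]; apply: le_trans (AM x) _.
by rewrite (le_trans (ler_norm _))// normrM normr_id ler_piMr.
Qed.

Lemma le_opnorm A x : `|A x| <= opnorm A * `|x|.
Proof.
have [->|x0] := eqVneq x 0; first by rewrite saop_lin0 !normr0 mulr0.
have nx0 : 0 < `|x| by rewrite normr_gt0.
have [_ [M AM] _] := saopP A.
have : `|A (`|x|^-1 *: x)| <= opnorm A.
  apply: sup_upper_bound; last first.
    exists (`|x|^-1 *: x) => //=.
    by rewrite normrZ normfV normr_id mulVf ?gt_eqF.
  split; first by exists `|A 0|, 0 => //=; rewrite normr0.
  exists `|M| => _ [y /= y1 <-]; apply: le_trans (AM y) _.
  by rewrite (le_trans (ler_norm _))// normrM normr_id ler_piMr.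
by rewrite saop_linZ normrZ normfV normr_id mulrC ler_pdivrMr.
Qed.

Lemma ler_inner_opnorm A x : `|inner (A x) x| <= opnorm A * `|x| ^+ 2.
Proof.
apply: le_trans (cauchy_schwarz _ _) _.
by rewrite expr2 mulrA ler_wpM2r// le_opnorm.
Qed.

Lemma psd_opnormB A : psd (opnorm A *: idop - A).
Proof.
move=> x; rewrite !saopDE/= !innerE inner_norm subr_ge0.
exact: le_trans (ler_norm _) (ler_inner_opnorm A x).
Qed.

Lemma psd_opnormD A : psd (opnorm A *: idop + A).
Proof.
move=> x; rewrite !saopDE/= !innerE inner_norm -lerBlDl sub0r.
by have := ler_inner_opnorm A x; rewrite ler_norml => /andP[].
Qed.

(** On the range of [C] one has [C + D = C], so [C] is positive there. The
    sequence [z_n = (1 - t C^2)^n x] differs from [x] by elements of this range,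
    and [t |C z_n|^2 <= |z_n|^2 - |z_(n+1)|^2] forces [C z_n] to get small. *)
Lemma psd_of_orthogonal_sum C D :
  (forall x, D (C x) = 0) -> psd (C + D) -> psd C.
Proof.
move=> DC0 CD x; rewrite leNgt; apply/negP => Cx.
have ranC y : 0 <= inner (C (C y)) (C y).
  by have := CD (C y); rewrite saopE DC0 addr0.
pose M := opnorm C + 1.
have M0 : 0 < M by rewrite ltr_pwDr// opnorm_ge0.
have CM y : `|C y| <= M * `|y|.
  by apply: le_trans (le_opnorm C y) _; rewrite ler_wpM2r// lerDl.
pose t := (M ^+ 2)^-1; have t0 : 0 < t by rewrite invr_gt0 exprn_gt0.
pose z n := iter n (fun y => y - t *: C (C y)) x.
have zS n : `|z n.+1| ^+ 2 <= `|z n| ^+ 2 - t * `|C (z n)| ^+ 2.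
  rewrite /z iterS -/(z n) -!inner_norm !innerE (innerC (z n)).
  rewrite (saop_comm C (C (z n)) (z n)).
  have -> : inner (C (C (z n))) (C (C (z n))) = `|C (C (z n))| ^+ 2.
    by rewrite inner_norm.
  have : t * (t * `|C (C (z n))| ^+ 2) <= t * inner (C (z n)) (C (z n)).
    rewrite ler_pM2l// mulrC ler_pdivrMr ?exprn_gt0// inner_norm mulrC -exprMn.
    by rewrite ler_pXn2r// nnegrE ?mulr_ge0// ltW.
  by lra.
have zrange n : exists y, z n = x - C y.
  elim: n => [|n [y IH]]; first by exists 0; rewrite saop_lin0 subr0.
  exists (y + t *: C (z n)); rewrite /z iterS -/(z n) !saop_lin.
  by rewrite opprD addrA -IH.
have zx n : `|z n| ^+ 2 <= `|x| ^+ 2.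
  elim: n => // n IH; apply: le_trans (zS n) _.
  by rewrite lerBlDr (le_trans IH)// lerDl mulr_ge0 ?sqr_ge0// ltW.
have Cz n : - inner (C x) x <= 3 * `|x| * `|C (z n)|.
  have [y zy] := zrange n; have := ranC y.
  have -> : C y = x - z n by rewrite zy opprB addrC subrK.
  rewrite !saop_lin !innerE => h.
  have h1 := cauchy_schwarz (C (z n)) x.
  have h2 := cauchy_schwarz (C (z n)) (z n).
  have h3 : `|C (z n)| * `|z n| <= `|C (z n)| * `|x|.
    by rewrite ler_wpM2l// -(ler_pXn2r (n := 2)) ?nnegrE.
  have h4 : inner (C x) (z n) = inner (C (z n)) x by rewrite saop_comm innerC.
  move: h1 h2; rewrite !ler_norml => /andP[h1 h1'] /andP[h2 h2'].
  by move: h; rewrite h4; nra.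
have x0 : 0 < `|x|.
  rewrite normr_gt0; apply: contraTneq Cx => ->.
  by rewrite saop_lin0 -(scale0r (0 : H)) innerZl mul0r ltxx.
pose del := - inner (C x) x / (3 * `|x|).
have x30 : 0 < 3 * `|x| by rewrite mulr_gt0.
have del0 : 0 < del by rewrite divr_gt0// oppr_gt0.
have Cdel n : del <= `|C (z n)| by rewrite ler_pdivrMr// mulrC; exact: Cz.
have zn n : `|z n| ^+ 2 <= `|x| ^+ 2 - n%:R * (t * del ^+ 2).
  elim: n => [|n IH]; first by rewrite mul0r subr0.
  apply: le_trans (zS n) _; rewrite -natr1 mulrDl mul1r.
  have : t * del ^+ 2 <= t * `|C (z n)| ^+ 2.
    by rewrite ler_pM2l// ler_pXn2r// nnegrE// ltW.
  by lra.
have tdel : 0 < t * del ^+ 2 by rewrite mulr_gt0// exprn_gt0.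
have := zn (Num.bound (`|x| ^+ 2 / (t * del ^+ 2))).
apply/negP; rewrite -ltNge; apply: (@lt_le_trans _ _ 0) (sqr_ge0 _).
rewrite subr_lt0 -ltr_pdivrMr//; apply: archi_boundP.
by rewrite divr_ge0// ltW.
Qed.

End Operators.

Lemma le0_of_vanishing (R : realType) (t C : R) (r : nat -> R) :
  r @ \oo --> 0 -> (forall n, t <= C * r n) -> t <= 0.
Proof.
move=> r0 tr; rewrite -(mulr0 C).
have Cr : (fun n => C * r n) @ \oo --> C * 0.
  by apply: cvgM r0; exact: cvg_cst.
by rewrite -(cvg_lim _ Cr)//; apply: limr_ge; [exact: cvgP Cr|exact: nearW].
Qed.

Section SquareRoot.
Context (R : realType) (H : hilbertType R).
Implicit Types (x y z : H) (A B S T : saop H).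

Lemma saop_sqr_subproof A : (A \o A) \in @saop_pred R H.
Proof.
apply/asboolP; split=> [a x y||x y] /=.
- by rewrite !saop_lin.
- exists (opnorm A * opnorm A) => x; apply: le_trans (le_opnorm _ _) _.
  by rewrite -mulrA ler_wpM2l ?opnorm_ge0// le_opnorm.
- by rewrite !saop_comm.
Qed.

Definition saop_sqr A : saop H := SAOp (saop_sqr_subproof A).

(** The solution [Y] of [Y = (T + Y^2) / 2] obtained by iteration satisfies
    [(1 - Y)^2 = 1 - T], which makes [1 - Y] a square root of [1 - T]. *)
Fixpoint sqrt_iter T n : saop H :=
  if n is n'.+1 then 2^-1 *: (T + saop_sqr (sqrt_iter T n')) else 0.

(** The same iteration for the scalar [T = 1]. It bounds the norms and also the
    increments of [sqrt_iter], so convergence in norm follows from that of a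
    bounded monotone sequence of reals. *)
Fixpoint sqrt_rate n : R :=
  if n is n'.+1 then 2^-1 * (1 + sqrt_rate n' ^+ 2) else 0.

Lemma sqrt_iter0 T x : sqrt_iter T 0 x = 0.
Proof. by []. Qed.

Lemma sqrt_iterS T n x : sqrt_iter T n.+1 x =
  2^-1 *: (T x + sqrt_iter T n (sqrt_iter T n x)).
Proof. by []. Qed.

Lemma sqrt_rate_bounds n : 0 <= sqrt_rate n <= 1.
Proof. by elim: n => [|n /andP[? ?]] /=; [rewrite lexx ler01|apply/andP; nra]. Qed.

Lemma sqrt_rateS n : sqrt_rate n <= sqrt_rate n.+1.
Proof. by have := sqr_ge0 (sqrt_rate n - 1); rewrite /=; nra. Qed.

Lemma sqrt_rate_nd : nondecreasing_seq sqrt_rate.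
Proof. exact/nondecreasing_seqP/sqrt_rateS. Qed.

Lemma sqrt_rate_cvg : sqrt_rate @ \oo --> sup (range sqrt_rate).
Proof.
apply: nondecreasing_cvgn; first exact: sqrt_rate_nd.
by exists 1 => _ [n _ <-]; have /andP[] := sqrt_rate_bounds n.
Qed.

Definition sqrt_gap n : R := sup (range sqrt_rate) - sqrt_rate n.

Lemma sqrt_gap_cvg : sqrt_gap @ \oo --> 0.
Proof.
rewrite -(subrr (sup (range sqrt_rate))).
by apply: cvgB; [exact: cvg_cst|exact: sqrt_rate_cvg].
Qed.

Lemma sqrt_rate_le n : sqrt_rate n <= sup (range sqrt_rate).
Proof.
apply: sup_upper_bound; last by exists n.
split; first by exists (sqrt_rate 0), 0%N.
by exists 1 => _ [m _ <-]; have /andP[] := sqrt_rate_bounds m.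
Qed.

Variable T : saop H.
Hypothesis T1 : forall x, `|T x| <= `|x|.
Local Notation Y := (sqrt_iter T).

Lemma sqrt_iter_rate n x : `|Y n x| <= sqrt_rate n * `|x|.
Proof.
elim: n x => [|n IH] x; first by rewrite sqrt_iter0 /= mul0r normr0.
have /andP[r0 r1] := sqrt_rate_bounds n.
rewrite sqrt_iterS normrZ ger0_norm ?invr_ge0//= -mulrA ler_pM2l ?invr_gt0//.
apply: le_trans (ler_normD _ _) _; rewrite mulrDl mul1r lerD//.
by apply: le_trans (IH _) _; rewrite expr2 -mulrA ler_wpM2l.
Qed.

Lemma sqrt_iter_le n x : `|Y n x| <= `|x|.
Proof.
apply: le_trans (sqrt_iter_rate n x) _.
by have /andP[_ r1] := sqrt_rate_bounds n; rewrite ler_piMl.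
Qed.

(** With [D = Y_(n+1) - Y_n], the next increment is
    [(Y_(n+1) D + D Y_n) / 2]; no commutation is involved. *)
Lemma sqrt_iter_incr n x :
  `|Y n.+1 x - Y n x| <= (sqrt_rate n.+1 - sqrt_rate n) * `|x|.
Proof.
elim: n x => [|n IH] x.
  rewrite sqrt_iterS !sqrt_iter0 addr0 subr0 normrZ ger0_norm ?invr_ge0//=.
  by rewrite expr0n/= addr0 mulr1 subr0 ler_pM2l ?invr_gt0.
rewrite sqrt_iterS [in X in _ - X]sqrt_iterS -scalerBr opprD addrACA subrr add0r.
have -> : Y n.+1 (Y n.+1 x) - Y n (Y n x) =
    Y n.+1 (Y n.+1 x - Y n x) + (Y n.+1 (Y n x) - Y n (Y n x)).
  by rewrite saop_linD saop_linN addrA subrK.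
rewrite normrZ ger0_norm ?invr_ge0//.
have h1 := sqrt_iter_rate n.+1 (Y n.+1 x - Y n x).
have h2 := IH (Y n x); have h3 := IH x.
have h4 := sqrt_iter_rate n x.
have /andP[r0 r1] := sqrt_rate_bounds n; have rS := sqrt_rateS n.
have /andP[rS0 _] := sqrt_rate_bounds n.+1.
have h5 := ler_normD (Y n.+1 (Y n.+1 x - Y n x)) (Y n.+1 (Y n x) - Y n (Y n x)).
have h6 := ler_wpM2l rS0 h3.
have h7 : (sqrt_rate n.+1 - sqrt_rate n) * `|Y n x| <=
    (sqrt_rate n.+1 - sqrt_rate n) * (sqrt_rate n * `|x|).
  by rewrite ler_wpM2l// subr_ge0.
have -> : sqrt_rate n.+2 - sqrt_rate n.+1 =
  2^-1 * (sqrt_rate n.+1 ^+ 2 - sqrt_rate n ^+ 2) by rewrite /=; ring.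
by lra.
Qed.

Lemma sqrt_iter_cauchy n m x : (n <= m)%N ->
  `|Y m x - Y n x| <= (sqrt_rate m - sqrt_rate n) * `|x|.
Proof.
elim: m => [|m IH]; first by rewrite leqn0 => /eqP ->; rewrite !subrr normr0 mul0r.
rewrite leq_eqVlt => /predU1P[->|]; first by rewrite !subrr normr0 mul0r.
rewrite ltnS => /IH nm; have := sqrt_iter_incr m x.
have := ler_normD (Y m.+1 x - Y m x) (Y m x - Y n x).
by rewrite addrA subrK; lra.
Qed.

Lemma sqrt_iter_cvg x : cvgn (fun n => Y n x).
Proof.
apply/cauchy_cvgP/cauchyP => e e0.
have : \forall n \near \oo, sqrt_gap n * (`|x| + 1) < e.
  have : (fun n => sqrt_gap n * (`|x| + 1)) @ \oo --> 0 * (`|x| + 1).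
    by apply: cvgM; [exact: sqrt_gap_cvg|exact: cvg_cst].
  by rewrite mul0r => /cvgr_lt; exact.
move=> [N _ HN].
exists (Y N x), N => // m /= Nm; rewrite -ball_normE /= distrC.
apply: le_lt_trans (HN N (leqnn N)).
apply: le_trans (sqrt_iter_cauchy x Nm) _; rewrite /sqrt_gap.
have := sqrt_rate_le m; have := sqrt_rate_le N; have := normr_ge0 x; nra.
Qed.

Definition sqrt_lim x : H := lim ((fun n => Y n x) @ \oo).

Lemma sqrt_lim_gap n x : `|sqrt_lim x - Y n x| <= sqrt_gap n * `|x|.
Proof.
have c : (fun m => `|Y m x - Y n x|) @ \oo --> `|sqrt_lim x - Y n x|.
  by apply: cvg_norm; apply: cvgB; [exact: sqrt_iter_cvg|exact: cvg_cst].
rewrite -(cvg_lim _ c)//; apply: limr_le; first exact: cvgP c.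
exists n => // m /= nm; apply: le_trans (sqrt_iter_cauchy x nm) _.
by rewrite ler_wpM2r// lerB// sqrt_rate_le.
Qed.

(** Identities for [sqrt_lim] are proved by replacing it with [sqrt_iter T n], for
    which they hold exactly or with [n] shifted by one, at the cost of a multiple
    of [sqrt_gap n]. *)
Lemma eq_of_gap x y (C : R) : (forall n, `|x - y| <= C * sqrt_gap n) -> x = y.
Proof.
move=> h; apply/eqP; rewrite -subr_eq0 -normr_le0.
exact: le0_of_vanishing sqrt_gap_cvg h.
Qed.

Lemma sqrt_lim_le x : `|sqrt_lim x| <= `|x|.
Proof.
rewrite -subr_le0; apply: (le0_of_vanishing (C := `|x|) sqrt_gap_cvg) => n.
have := ler_normD (sqrt_lim x - Y n x) (Y n x); rewrite subrK.
by have := sqrt_iter_le n x; have := sqrt_lim_gap n x; lra.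
Qed.

Lemma sqrt_lim_saop : sqrt_lim \in @saop_pred R H.
Proof.
apply/asboolP; split.
- move=> a x y; apply: (eq_of_gap (C := `|a *: x + y| + `|a| * `|x| + `|y|)) => n.
  have -> : sqrt_lim (a *: x + y) - (a *: sqrt_lim x + sqrt_lim y) =
      (sqrt_lim (a *: x + y) - Y n (a *: x + y))
      - (a *: (sqrt_lim x - Y n x) + (sqrt_lim y - Y n y)).
    rewrite !saop_lin scalerBr addrACA -opprD opprB addrA subrK.
    by rewrite opprD addrC.
  have h0 := sqrt_lim_gap n (a *: x + y).
  have h1 := ler_wpM2l (normr_ge0 a) (sqrt_lim_gap n x).
  have h2 := sqrt_lim_gap n y.
  apply: le_trans (ler_normB _ _) _.
  have := ler_normD (a *: (sqrt_lim x - Y n x)) (sqrt_lim y - Y n y).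
  by rewrite normrZ; lra.
- by exists 1 => x; rewrite mul1r sqrt_lim_le.
- move=> x y; apply/eqP; rewrite -subr_eq0 -normr_le0.
  apply: (le0_of_vanishing (C := 2 * `|x| * `|y|) sqrt_gap_cvg) => n.
  have -> : inner (sqrt_lim x) y - inner x (sqrt_lim y) =
      inner (sqrt_lim x - Y n x) y - inner x (sqrt_lim y - Y n y).
    by rewrite !innerE saop_comm; ring.
  apply: le_trans (ler_normB _ _) _.
  have h1 := cauchy_schwarz (sqrt_lim x - Y n x) y.
  have h2 := cauchy_schwarz x (sqrt_lim y - Y n y).
  have h3 := ler_wpM2r (normr_ge0 y) (sqrt_lim_gap n x).
  have h4 := ler_wpM2l (normr_ge0 x) (sqrt_lim_gap n y).
  by lra.
Qed.

Lemma sqrt_lim_fix x : sqrt_lim x = 2^-1 *: (T x + sqrt_lim (sqrt_lim x)).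
Proof.
apply: (eq_of_gap (C := 2 * `|x|)) => n.
have -> : sqrt_lim x - 2^-1 *: (T x + sqrt_lim (sqrt_lim x)) =
    (sqrt_lim x - Y n.+1 x) - 2^-1 *: (Y n (sqrt_lim x - Y n x)
                           + (sqrt_lim (sqrt_lim x) - Y n (sqrt_lim x))).
  rewrite sqrt_iterS -[RHS]addrA; congr (_ + _); rewrite -opprD -scalerDr.
  congr (- (_ *: _)); rewrite -addrA; congr (_ + _).
  by rewrite !saop_lin addrA [Y n (Y n x) + _]addrC subrK addrC subrK.
have h0 := sqrt_lim_gap n.+1 x.
have h1 := sqrt_iter_le n (sqrt_lim x - Y n x).
have h2 := sqrt_lim_gap n x.
have h3 := sqrt_lim_gap n (sqrt_lim x).
have h4 : sqrt_gap n * `|sqrt_lim x| <= sqrt_gap n * `|x|.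
  by rewrite ler_wpM2l ?sqrt_lim_le// subr_ge0 sqrt_rate_le.
have h5 : sqrt_gap n.+1 * `|x| <= sqrt_gap n * `|x|.
  by rewrite ler_wpM2r// lerB// sqrt_rateS.
apply: le_trans (ler_normB _ _) _; rewrite normrZ ger0_norm ?invr_ge0//.
have := ler_normD (Y n (sqrt_lim x - Y n x))
  (sqrt_lim (sqrt_lim x) - Y n (sqrt_lim x)).
by lra.
Qed.

Lemma sqrt_lim_comm S : (forall x, S (T x) = T (S x)) ->
  forall x, S (sqrt_lim x) = sqrt_lim (S x).
Proof.
move=> ST; have SY n x : S (Y n x) = Y n (S x).
  elim: n x => [|n IH] x; first by rewrite !sqrt_iter0 saop_lin0.
  by rewrite !sqrt_iterS saop_linZ saop_linD ST !IH.
move=> x; apply: (eq_of_gap (C := opnorm S * `|x| + `|S x|)) => n.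
have -> : S (sqrt_lim x) - sqrt_lim (S x) =
    S (sqrt_lim x - Y n x) - (sqrt_lim (S x) - Y n (S x)).
  by rewrite !saop_lin SY opprB addrA subrK.
apply: le_trans (ler_normB _ _) _.
have h0 := le_opnorm S (sqrt_lim x - Y n x).
have h1 := ler_wpM2l (opnorm_ge0 S) (sqrt_lim_gap n x).
have h2 := sqrt_lim_gap n (S x).
by lra.
Qed.

End SquareRoot.

(** Here [B = 1 - Y] is the modulus of the contraction [A], and the parts are
    [(B + A) / 2] and [(B - A) / 2], up to rescaling. *)
Lemma posneg_parts_exist (R : realType) (H : hilbertType R) (A : saop H) :
  exists PN, posneg_parts A PN.
Proof.
pose c := opnorm A + 1; have c0 : 0 < c by rewrite ltr_pwDr// opnorm_ge0.
have [A1 A1A A1c] : exists2 A1 : saop H, c *: A1 = A & forall x, `|A1 x| <= `|x|.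
  exists (c^-1 *: A); first by rewrite scalerA divff ?gt_eqF// scale1r.
  move=> x; rewrite saopZ normrZ ger0_norm ?invr_ge0 ?(ltW c0)// mulrC ler_pdivrMr//.
  by apply: le_trans (le_opnorm A x) _; rewrite mulrC ler_wpM2l// lerDl.
pose T := idop H - saop_sqr A1.
have Tx x : T x = x - A1 (A1 x) by [].
have T1 x : `|T x| <= `|x|.
  rewrite -(ler_pXn2r (n := 2)) ?nnegrE// -!inner_norm Tx !innerE.
  rewrite (innerC x) (saop_comm A1 (A1 x) x) !inner_norm.
  have := A1c (A1 x); rewrite -[_ <= `|A1 x|](ler_pXn2r (n := 2)) ?nnegrE// => h.
  by have := sqr_ge0 `|A1 x|; lra.
pose Y : saop H := SAOp (sqrt_lim_saop T1).
have Yfix x : Y x = 2^-1 *: (T x + Y (Y x)) by exact: sqrt_lim_fix.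
have YA x : A1 (Y x) = Y (A1 x).
  by apply: sqrt_lim_comm => // y; rewrite !Tx !saop_lin.
pose B := idop H - Y.
have Bx x : B x = x - Y x by [].
have BA x : A1 (B x) = B (A1 x) by rewrite !Bx !saop_lin YA.
have BB x : B (B x) = A1 (A1 x).
  have h : Y x + Y x = T x + Y (Y x).
    by rewrite -mulr2n -scaler_nat {1}(Yfix x) scalerA divff ?pnatr_eq0// scale1r.
  have -> : A1 (A1 x) = x + Y (Y x) - (Y x + Y x).
    by rewrite h Tx opprD opprB addrACA subrr addr0 addrC subrK.
  by rewrite !Bx !saop_lin [- (Y x - _)]opprB addrACA -opprD.
have Bpsd : psd B.
  move=> x; rewrite Bx !innerE inner_norm subr_ge0.
  have := cauchy_schwarz (Y x) x; rewrite ler_norml => /andP[_ h].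
  by apply: le_trans h _; rewrite expr2 ler_wpM2r// sqrt_lim_le.
move: B Bx BA BB Bpsd => B _ BA BB Bpsd.
pose C := B - A1; pose D := B + A1.
have Cx x : C x = B x - A1 x by [].
have Dx x : D x = B x + A1 x by [].
have DC x : D (C x) = 0.
  by rewrite Dx !Cx !saop_lin BB BA addrA subrK subrr.
have CD x : C (D x) = 0.
  by rewrite Cx !Dx !saop_lin BB BA [X in _ - X]addrC subrr.
have CDpsd : psd (C + D).
  by rewrite /C /D addrACA addNr addr0; exact: psdD.
have Cpsd : psd C by exact: psd_of_orthogonal_sum CDpsd.
have Dpsd : psd D by apply: psd_of_orthogonal_sum CD _; rewrite addrC.
have scale0 (a : R) (P Q : saop H) : (forall x, P (Q x) = 0) ->
    forall x, (a *: P) ((a *: Q) x) = 0.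
  by move=> PQ x; rewrite !saopZ saop_linZ PQ !scaler0.
have c20 : 0 <= c / 2 by rewrite divr_ge0// ltW.
exists ((c / 2) *: D, (c / 2) *: C); split => /=.
- exact: psdZ.
- exact: psdZ.
- rewrite -scalerBr /C /D opprB addrC addrA subrK -mulr2n -[A1 *+ 2]scaler_nat.
  rewrite scalerA.
  by rewrite divfK ?pnatr_eq0// A1A.
- exact: scale0 DC.
- exact: scale0 CD.
Qed.

(** * Regularization of finitely additive set functions *)

Section ScaledBounds.
Context (R : realType).
Implicit Types (A : set R) (s c : R).

Lemma mul_sup_le A s c : 0 <= s -> A !=set0 -> (forall a, A a -> s * a <= c) ->
  s * sup A <= c.
Proof.
rewrite le_eqVlt => /predU1P[<-|s0] A0 h.
  by have [a Aa] := A0; have := h a Aa; rewrite !mul0r.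
rewrite mulrC -ler_pdivlMr//; apply: (ge_sup A0) => a Aa.
by rewrite ler_pdivlMr// mulrC; exact: h.
Qed.

Lemma le_mul_inf A s c : 0 <= s -> A !=set0 -> (forall a, A a -> c <= s * a) ->
  c <= s * inf A.
Proof.
rewrite le_eqVlt => /predU1P[<-|s0] A0 h.
  by have [a Aa] := A0; have := h a Aa; rewrite !mul0r.
rewrite mulrC -ler_pdivrMr//; apply: (lb_le_inf A0) => a Aa.
by rewrite ler_pdivrMr// mulrC; exact: h.
Qed.

End ScaledBounds.

Definition finitely_additive (R : realType) (T : Type) (n : set T -> R) :=
  (forall S, 0 <= n S) /\
  (forall S S', S `&` S' = set0 -> n (S `|` S') = n S + n S').

Section FinitelyAdditive.
Context (R : realType) (T : Type) (n : set T -> R).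
Hypothesis nP : finitely_additive n.

Lemma fadd_ge0 S : 0 <= n S. Proof. exact: nP.1. Qed.

Lemma fadd_set0 : n set0 = 0.
Proof.
have := nP.2 set0 set0 (setI0 _); rewrite setU0 => /esym/eqP.
by rewrite -subr_eq0 addrK => /eqP.
Qed.

Lemma fadd_le S S' : S `<=` S' -> n S <= n S'.
Proof.
move=> SS'; rewrite -(setDUK SS') nP.2 ?lerDl ?fadd_ge0//.
by rewrite setDE setICA setICr setI0.
Qed.

Lemma fadd_leU S S' : n (S `|` S') <= n S + n S'.
Proof.
rewrite -(setDUK (@subsetUl _ S S')) nP.2.
  by rewrite lerD2l; apply: fadd_le => x [[]].
by rewrite setDE setICA setICr setI0.
Qed.

Lemma fadd_le_sum (S : nat -> set T) N :
  n (\big[setU/set0]_(i < N) S i) <= \sum_(i < N) n (S i).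
Proof.
elim: N => [|N IH]; first by rewrite !big_ord0 fadd_set0.
rewrite !big_ord_recr /=; apply: le_trans (fadd_leU _ _) _.
by rewrite lerD2r.
Qed.

End FinitelyAdditive.

Section Regularization.
Context (R : realType) (T : normedModType R).
Implicit Types (n : set T -> R) (S E U V K : set T).

(** The value at an open set of the measure to be built: [n] itself may charge
    sets escaping every compact subset of [U], and that part is discarded. *)
Definition inner_content n U := sup [set n K | K in [set K | compact K /\ K `<=` U]].

Definition outer_content n E :=
  inf [set inner_content n U | U in [set U | open U /\ E `<=` U]].

Section Content.
Variable n : set T -> R.
Hypothesis nP : finitely_additive n.

Let inner_ne U : [set n K | K in [set K | compact K /\ K `<=` U]] !=set0.
Proof. by exists (n set0), set0 => //=; split=> //; exact: compact0. Qed.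

Lemma inner_content_ge K U : compact K -> K `<=` U -> n K <= inner_content n U.
Proof.
move=> cK KU; apply: ub_le_sup; last by exists K.
by exists (n setT) => _ [K' _ <-]; exact: fadd_le.
Qed.

Lemma inner_content_le U (c : R) :
  (forall K, compact K -> K `<=` U -> n K <= c) -> inner_content n U <= c.
Proof.
by move=> h; apply: (ge_sup (inner_ne U)) => _ [K [cK KU] <-]; exact: h.
Qed.

Lemma inner_content_le_fadd U : inner_content n U <= n U.
Proof. by apply: inner_content_le => K _ KU; exact: fadd_le. Qed.

Lemma inner_content_ge0 U : 0 <= inner_content n U.
Proof.
by rewrite -(fadd_set0 nP); apply: inner_content_ge => //; exact: compact0.
Qed.

Lemma inner_content_mono U V : U `<=` V -> inner_content n U <= inner_content n V.
Proof.
move=> UV; apply: inner_content_le => K cK KU.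
by apply: inner_content_ge => //; exact: subset_trans UV.
Qed.

Lemma compact_setI_closed K V : compact K -> closed V -> compact (K `&` V).
Proof.
move=> cK cV; apply: (subclosed_compact _ cK); last exact: subIsetl.
by apply: closedI => //; apply: compact_closed cK; exact: norm_hausdorff.
Qed.

(** A compact set covered by open sets is a finite union of compact pieces, each
    inside one member of the cover: gather the closures of small neighbourhoods. *)
Lemma compact_split K (U : nat -> set T) : compact K ->
  (forall i, open (U i)) -> K `<=` \bigcup_i U i ->
  exists N (P : nat -> set T), [/\ K `<=` \big[setU/set0]_(i < N) P i,
    forall i, compact (P i) & forall i, P i `<=` U i].
Proof.
move=> cK oU KU.
have /choice[f fP] : forall x, exists iV : nat * set T, K x ->
    [/\ open iV.2, iV.2 x & closure iV.2 `<=` U iV.1].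
  move=> x; have [Kx|nKx] := pselect (K x); last by exists (0%N, set0).
  have [i _ Uix] := KU x Kx.
  have [A Ax AU] : filter_from (nbhs x) closure (U i).
    by apply: uniform_regular; exact: open_nbhs_nbhs.
  exists (i, A^°) => _ /=; split; first exact: open_interior.
    exact: nbhs_singleton (nbhs_interior Ax).
  by apply: subset_trans AU; apply: closure_subset; exact: interior_subset.
have cK' : cover_compact K by rewrite -compact_cover.
have [||D DK KD] := cK' T K (fun x => (f x).2).
- by move=> x Kx; have [] := fP x Kx.
- by move=> x Kx; exists x => //; have [] := fP x Kx.
pose P i := \big[setU/set0]_(x <- enum_fset D | (f x).1 == i) (K `&` closure (f x).2).
exists (\max_(x <- enum_fset D) (f x).1).+1, P; split.
- move=> y Ky; have [x /= xD fxy] := KD y Ky.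
  have lt_fx : ((f x).1 < (\max_(x <- enum_fset D) (f x).1).+1)%N.
    by rewrite ltnS; exact: leq_bigmax_seq.
  rewrite -bigcup_mkord; exists (f x).1 => //; rewrite /P -bigcup_seq_cond.
  by exists x; [rewrite /= eqxx andbT|split=> //; exact: subset_closure].
- move=> i; apply: bigsetU_compact => x _.
  by apply: compact_setI_closed => //; exact: closed_closure.
- move=> i y; rewrite /P -bigcup_seq_cond => -[x /= /andP[xD /eqP <-] [_ Cy]].
  have Kx : K x by have := DK x xD; rewrite inE.
  by have [_ _] := fP x Kx; exact.
Qed.

Lemma inner_content_bigcup K (U : nat -> set T) : compact K ->
  (forall i, open (U i)) -> K `<=` \bigcup_i U i ->
  exists N, n K <= \sum_(i < N) inner_content n (U i).
Proof.
move=> cK oU KU; have [N [P [KP cP PU]]] := compact_split cK oU KU.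
exists N; apply: le_trans (fadd_le nP KP) _.
apply: le_trans (fadd_le_sum nP P N) _; apply: ler_sum => i _.
exact: inner_content_ge.
Qed.

Let outer_ne E : [set inner_content n U | U in [set U | open U /\ E `<=` U]] !=set0.
Proof. by exists (inner_content n setT), setT => //=; split=> //; exact: openT. Qed.

Lemma outer_content_le E U : open U -> E `<=` U ->
  outer_content n E <= inner_content n U.
Proof.
move=> oU EU; apply: ge_inf; last by exists U.
by exists 0 => _ [V _ <-]; exact: inner_content_ge0.
Qed.

Lemma outer_content_ge E (c : R) :
  (forall U, open U -> E `<=` U -> c <= inner_content n U) ->
  c <= outer_content n E.
Proof.
by move=> h; apply: (lb_le_inf (outer_ne E)) => _ [U [oU EU] <-]; exact: h.
Qed.

Lemma outer_content_open U : open U -> outer_content n U = inner_content n U.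
Proof.
move=> oU; apply/le_anti/andP; split; first exact: outer_content_le.
by apply: outer_content_ge => V _; exact: inner_content_mono.
Qed.

Lemma outer_content_ge0 E : 0 <= outer_content n E.
Proof. by apply: outer_content_ge => *; exact: inner_content_ge0. Qed.

Lemma outer_content_mono E E' : E `<=` E' -> outer_content n E <= outer_content n E'.
Proof.
move=> EE'; apply: outer_content_ge => U oU EU; apply: outer_content_le => //.
exact: subset_trans EU.
Qed.

Lemma outer_content_le_fadd U : open U -> outer_content n U <= n U.
Proof. by move=> oU; rewrite outer_content_open// inner_content_le_fadd. Qed.

Lemma outer_content_set0 : outer_content n set0 = 0.
Proof.
apply/le_anti; rewrite outer_content_ge0 andbT -(fadd_set0 nP).
by apply: outer_content_le_fadd; exact: open0.
Qed.

Lemma outer_content_bigcup : sigma_subadditive (fun E => (outer_content n E)%:E).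
Proof.
move=> F; apply/lee_addgt0Pr => e e0.
have /choice[U UP] : forall i, exists U, [/\ open U, F i `<=` U &
    inner_content n U <= outer_content n (F i) + e / (2 ^ i.+1)%:R].
  move=> i; have ei : 0 < e / (2 ^ i.+1)%:R by rewrite divr_gt0// ltr0n expn_gt0.
  have hi : has_inf [set inner_content n U | U in [set U | open U /\ F i `<=` U]].
    split; first exact: outer_ne.
    by exists 0 => _ [V _ <-]; exact: inner_content_ge0.
  have [_ [U [oU FU] <-] /ltW] := inf_adherent ei hi.
  by exists U.
apply: le_trans (epsilon_trick _ _ (ltW e0)); last first.
  by move=> i; rewrite lee_fin outer_content_ge0.
set s := (X in (_ <= X)%E).
have s_ge N : ((\sum_(i < N) inner_content n (U i))%:E <= s)%E.
  apply: (@le_trans _ _ (\sum_(0 <= i < N) (outer_content n (F i) +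
    e / (2 ^ i.+1)%:R)%:E)%E); last first.
    apply: nneseries_lim_ge => i _ _.
    by rewrite lee_fin addr_ge0 ?outer_content_ge0 ?divr_ge0 ?(ltW e0).
  rewrite big_mkord sumEFin lee_fin; apply: ler_sum => i _.
  by have [] := UP i.
apply: (@le_trans _ _ (inner_content n (\bigcup_i U i))%:E).
  rewrite lee_fin; apply: outer_content_le.
    by apply: bigcup_open => i _; have [] := UP i.
  by apply: subset_bigcup => i _; have [] := UP i.
have K_le K : compact K -> K `<=` \bigcup_i U i -> ((n K)%:E <= s)%E.
  move=> cK KU; have [|N KN] := inner_content_bigcup cK _ KU.
    by move=> i; have [] := UP i.
  by apply: le_trans (s_ge N); rewrite lee_fin.
case: s s_ge K_le => [r _ K_le|_ _|/(_ 0%N)]; rewrite ?leey//.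
by rewrite lee_fin; apply: inner_content_le => K cK KU; rewrite -lee_fin; exact: K_le.
Qed.

Lemma outer_content_outer_measure :
  exists mu : {outer_measure set T -> \bar R},
    (mu : set T -> \bar R) = fun E => (outer_content n E)%:E.
Proof.
pose f (E : set T) := (outer_content n E)%:E.
have f0 : f set0 = 0%E by rewrite /f outer_content_set0.
have fge0 E : (0 <= f E)%E by rewrite lee_fin outer_content_ge0.
have fle : {homo f : A B / A `<=` B >-> (A <= B)%E}.
  by move=> A B AB; rewrite lee_fin outer_content_mono.
pose fO := isOuterMeasure.Build R T f f0 fge0 fle outer_content_bigcup.
by exists (HB.pack f fO : {outer_measure set T -> \bar R}).
Qed.

Lemma outer_contentU E E' :
  outer_content n (E `|` E') <= outer_content n E + outer_content n E'.
Proof.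
have [mu muE] := outer_content_outer_measure.
by have := outer_measureU2 mu E E'; rewrite muE lee_fin.
Qed.

(** Test sets may be replaced by open [V] containing them; there, additivity of
    [n] on disjoint compact sets applies to [K] inside [V `&` U] and [K'] inside
    [V `\` K]. *)
Lemma outer_content_caratheodory U E : open U ->
  outer_content n (E `&` U) + outer_content n (E `&` ~` U) <= outer_content n E.
Proof.
move=> oU; apply: outer_content_ge => V oV EV.
apply: (@le_trans _ _ (inner_content n (V `&` U) + outer_content n (E `&` ~` U))).
  rewrite lerD2r; apply: outer_content_le; first exact: openI.
  exact: setSI.
rewrite -lerBrDr; apply: inner_content_le => K cK KVU.
have oVK : open (V `\` K).
  rewrite setDE; apply: openI => //; apply: closed_openC.
  by apply: compact_closed cK; exact: norm_hausdorff.
rewrite lerBrDr -lerBrDl.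
apply: (@le_trans _ _ (inner_content n (V `\` K))).
  apply: outer_content_le => // x [Ex nUx]; split; first exact: EV.
  by move=> /KVU[].
apply: inner_content_le => K' cK' K'V; rewrite lerBrDl -nP.2; last first.
  by apply/seteqP; split=> // x [Kx /K'V[_ /(_ Kx)]].
apply: inner_content_ge; first exact: compactU.
by rewrite subUset; split=> x; [move=> /KVU[]|move=> /K'V[]].
Qed.

Lemma outer_content_measure :
  exists mu : {measure set (g_sigma_algebraType (@open T)) -> \bar R},
    forall E, mu E = (outer_content n E)%:E.
Proof.
have [mu muE] := outer_content_outer_measure.
have openM U : open U -> mu.-caratheodory U.
  move=> oU; apply: le_caratheodory_measurable => E.
  by rewrite muE -EFinD lee_fin; exact: outer_content_caratheodory.
have borelM (D : set (g_sigma_algebraType (@open T))) : measurable D -> mu.-caratheodory D.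
  move=> mD; apply: (mD (mu.-caratheodory)); split; last exact: openM.
  split; first exact: caratheodory_measurable_set0.
    by move=> A cA; rewrite setTD; exact: caratheodory_measurable_setC.
  by move=> A cA; exact: caratheodory_measurable_bigcup.
have muadd : semi_sigma_additive (mu : set (g_sigma_algebraType (@open T)) -> \bar R).
  move=> F mF tF mUF.
  apply: (@caratheodory_measure_sigma_additive _ _ mu) => //.
  - by move=> i; exact: borelM.
  - exact: borelM.
pose fM := isMeasure.Build _ (g_sigma_algebraType (@open T)) R mu
  (outer_measure0 mu) (outer_measure_ge0 mu) muadd.
pose nu : {measure set (g_sigma_algebraType (@open T)) -> \bar R} := HB.pack (mu : set T -> \bar R) fM.
by exists nu => E; rewrite -[nu E]/(mu E) muE.
Qed.

(** Tightness excludes mass at infinity, which the compact sets would miss. *)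
Lemma outer_content_setT :
  (forall e : R, 0 < e -> exists K, compact K /\ n (~` K) <= e) ->
  outer_content n setT = n setT.
Proof.
move=> tight; apply/le_anti; rewrite outer_content_le_fadd/=; last exact: openT.
rewrite outer_content_open; last exact: openT.
apply/ler_addgt0Pr => e /tight[K [cK Ke]].
rewrite -(setUv K); apply: le_trans (fadd_leU nP _ _) _; apply: lerD => //.
exact: inner_content_ge.
Qed.

End Content.

Section Combination.
Variables (n n1 n2 : set T -> R) (s t : R).
Hypotheses (nP : finitely_additive n) (n1P : finitely_additive n1)
  (n2P : finitely_additive n2) (s0 : 0 <= s) (t0 : 0 <= t)
  (nE : forall S, n S = s * n1 S + t * n2 S).

(** The regularization is linear on the cone of finitely additive set functions:
    unions of compact sets and intersections of open sets serve both set functions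
    at once. *)
Lemma inner_content_comb U :
  inner_content n U = s * inner_content n1 U + t * inner_content n2 U.
Proof.
have ne (k : set T -> R) : [set k K | K in [set K : set T | compact K /\ K `<=` U]] !=set0.
  by exists (k set0), set0 => //=; split=> //; exact: compact0.
apply/le_anti/andP; split.
  apply: inner_content_le => K cK KU; rewrite nE.
  by apply: lerD; apply: ler_wpM2l => //; exact: inner_content_ge.
rewrite -lerBrDr; apply: (mul_sup_le s0 (ne _)) => _ [K1 [cK1 K1U] <-].
rewrite lerBrDr -lerBrDl; apply: (mul_sup_le t0 (ne _)) => _ [K2 [cK2 K2U] <-].
rewrite lerBrDl.
apply: (@le_trans _ _ (n (K1 `|` K2))).
  by rewrite nE; apply: lerD; apply: ler_wpM2l => //; apply: fadd_le.
by apply: inner_content_ge => //; [exact: compactU|rewrite subUset].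
Qed.

Lemma outer_content_comb E :
  outer_content n E = s * outer_content n1 E + t * outer_content n2 E.
Proof.
have ne (k : set T -> R) : [set inner_content k U | U in [set U | open U /\ E `<=` U]] !=set0.
  by exists (inner_content k setT), setT => //=; split=> //; exact: openT.
apply/le_anti/andP; split; last first.
  apply: outer_content_ge => U oU EU; rewrite inner_content_comb.
  by apply: lerD; apply: ler_wpM2l => //; exact: outer_content_le.
rewrite -lerBlDr; apply: (le_mul_inf s0 (ne _)) => _ [U1 [oU1 EU1] <-].
rewrite lerBlDr -lerBlDl; apply: (le_mul_inf t0 (ne _)) => _ [U2 [oU2 EU2] <-].
rewrite lerBlDl.
apply: (@le_trans _ _ (inner_content n (U1 `&` U2))).
  by apply: outer_content_le; [by []|exact: openI|rewrite subsetI].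
rewrite inner_content_comb.
by apply: lerD; apply: ler_wpM2l => //; apply: inner_content_mono.
Qed.

End Combination.
End Regularization.

(** * Extension of the functional to operator-valued step functions *)

Section OppolyLinear.
Context (R : realType) (d : nat) (H : hilbertType R).
Implicit Types (F : oppoly d H) (A B : saop H) (p q : mpoly d R) (a : 'rV[R]_d).

Lemma oppoly_evalZ (c : R) F a : oppoly_eval (c *: F) a = c *: oppoly_eval F a.
Proof.
pose r := fsetU (monalg.msupp F) (monalg.msupp (c *: F)).
rewrite !(@oppoly_evalEw _ _ _ _ _ r) ?fsubsetUl ?fsubsetUr//.
rewrite scaler_sumr; apply: eq_bigr => k _.
by rewrite mcoeff_oppolyZ !scalerA mulrC.
Qed.

Lemma tensorDl p q A : tensor (p + q) A = tensor p A + tensor q A.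
Proof.
apply/malgP => k.
by rewrite monalg.mcoeffD !mcoeff_tensor mpoly.mcoeffD scalerDl.
Qed.

Lemma tensorDr p A B : tensor p (A + B) = tensor p A + tensor p B.
Proof. by apply/malgP => k; rewrite monalg.mcoeffD !mcoeff_tensor scalerDr. Qed.

Lemma tensorZl (c : R) p A : tensor (c *: p) A = c *: tensor p A.
Proof.
apply/malgP => k.
by rewrite mcoeff_oppolyZ !mcoeff_tensor mpoly.mcoeffZ scalerA.
Qed.

Lemma tensorZr (c : R) p A : tensor p (c *: A) = c *: tensor p A.
Proof.
apply/malgP => k.
by rewrite mcoeff_oppolyZ !mcoeff_tensor !scalerA mulrC.
Qed.

Lemma tensorBl p q A : tensor (p - q) A = tensor p A - tensor q A.
Proof. by rewrite -[- q]scaleN1r tensorDl tensorZl scaleN1r. Qed.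

Lemma tensorBr p A B : tensor p (A - B) = tensor p A - tensor p B.
Proof. by rewrite -[- B]scaleN1r tensorDr tensorZr scaleN1r. Qed.

Lemma poly_funD p q a : poly_fun (p + q) a = poly_fun p a + poly_fun q a.
Proof. exact: mevalD. Qed.

Lemma poly_funM p q a : poly_fun (p * q) a = poly_fun p a * poly_fun q a.
Proof. exact: mevalM. Qed.

Lemma poly_funZ (c : R) p a : poly_fun (c *: p) a = c * poly_fun p a.
Proof. exact: mevalZ. Qed.

Lemma poly_fun1 a : poly_fun 1 a = 1.
Proof. exact: meval1. Qed.

Lemma poly_fun0 a : poly_fun 0 a = 0.
Proof. by rewrite -(scale0r 1) poly_funZ mul0r. Qed.

Lemma poly_funB p q a : poly_fun (p - q) a = poly_fun p a - poly_fun q a.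
Proof. by rewrite -scaleN1r poly_funD poly_funZ mulN1r. Qed.

(** Every polynomial is a difference of two squares, so it is enough to
    integrate nonnegative polynomials. *)
Lemma poly_polarization p :
  exists q, p = (q + 1) * (q + 1) - q * q.
Proof.
pose q : mpoly d R := 2^-1 *: (p - 1); exists q.
rewrite -!expr2 subr_sqr [q + 1]addrC addrK mul1r -addrA /q -scalerDl.
by rewrite (_ : 2^-1 + 2^-1 = 1) ?scale1r 1?addrC ?subrK//; lra.
Qed.

End OppolyLinear.

Section Dominated.
Context (R : realType) (d : nat) (H : hilbertType R) (X : set 'rV[R]_d).
Implicit Types (F : oppoly d H) (A B : saop H) (G : 'rV[R]_d -> saop H).

(** Domination by polynomials on [X] is what the extension theorem requires of the
    functions that the functional is extended to. *)
Definition dominated_pred : {pred 'rV[R]_d -> saop H} := fun G =>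
  `[< exists F, forall a, X a ->
        psd (oppoly_eval F a - G a) /\ psd (oppoly_eval F a + G a) >].

Lemma dominated_submod_closed : submod_closed dominated_pred.
Proof.
split=> [|c G G' /asboolP[F FG] /asboolP[F' FG']]; apply/asboolP.
  exists (0 *: 0) => a _; rewrite oppoly_evalZ scale0r.
  have -> : (0 : 'rV[R]_d -> saop H) a = 0 by [].
  by rewrite subr0 addr0; split; exact: psd0.
exists (`|c| *: F + F') => a Xa; rewrite oppoly_evalD oppoly_evalZ.
have -> : (c *: G + G') a = c *: G a + G' a by [].
have [FGa FGa'] := FG a Xa; have [FG'a FG'a'] := FG' a Xa.
have [k1 k2] : psd (`|c| *: oppoly_eval F a - c *: G a) /\
    psd (`|c| *: oppoly_eval F a + c *: G a).
  have [c0|c0] := leP 0 c.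
    by rewrite (ger0_norm c0) -scalerBr -scalerDr; split; exact: psdZ.
  rewrite (ltr0_norm c0) -[c *: G a]opprK -scaleNr opprK -scalerDr -scalerBr.
  by split; apply: psdZ => //; rewrite oppr_ge0 ltW.
by rewrite opprD addrACA [in X in _ /\ X]addrACA; split; exact: psdD.
Qed.

HB.instance Definition _ :=
  GRing.isSubmodClosed.Build R ('rV[R]_d -> saop H) dominated_pred
    dominated_submod_closed.

Record domfun := DomFun {
  domfun_fun :> 'rV[R]_d -> saop H ; _ : domfun_fun \in dominated_pred }.

HB.instance Definition _ := [isSub for domfun_fun].
HB.instance Definition _ := [Choice of domfun by <:].
HB.instance Definition _ := [SubChoice_isSubLmodule of domfun by <:].

Lemma domfunD (G G' : domfun) a : (G + G') a = G a + G' a. Proof. by []. Qed.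
Lemma domfunZ (c : R) (G : domfun) a : (c *: G) a = c *: G a. Proof. by []. Qed.
Lemma domfunN (G : domfun) a : (- G) a = - G a. Proof. by []. Qed.

Lemma domfun_sum I (s : seq I) (G : I -> domfun) a :
  (\sum_(i <- s) G i) a = \sum_(i <- s) G i a.
Proof. by elim/big_rec2 : _ => // i x y _ <-. Qed.

Lemma dominated_scale (g : 'rV[R]_d -> R) (q : mpoly d R) A :
  (forall a, `|g a| <= poly_fun q a) -> (fun a => g a *: A) \in dominated_pred.
Proof.
move=> gq; apply/asboolP; exists (tensor q (opnorm A *: idop H)) => a _.
rewrite oppoly_eval_tensor.
have h x : `|g a * inner (A x) x| <=
    poly_fun q a * inner ((opnorm A *: idop H) x) x.
  rewrite normrM saopZ innerZl /= inner_norm.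
  by apply: ler_pM => //; exact: ler_inner_opnorm.
split=> x; have := h x; rewrite ler_norml !(saopE, saopN, saopZ (g a), saopZ (poly_fun q a)).
  by rewrite !(innerDl, innerNl) !(innerZl (g a), innerZl (poly_fun q a)); lra.
by rewrite !(innerDl, innerNl) !(innerZl (g a), innerZl (poly_fun q a)); lra.
Qed.

(** A monomial is bounded by one plus its square. *)
Lemma dominated_eval F : oppoly_eval F \in dominated_pred.
Proof.
have -> : oppoly_eval F =
    \sum_(k <- monalg.msupp F) fun a => poly_fun (mpolyX R k) a *: monalg.mcoeff k F.
  by apply/funext => a; rewrite fct_sumE oppoly_eval.unlock.
apply: rpred_sum => k _; apply: (dominated_scale (q := 1 + mpolyX R k * mpolyX R k)) => a.
rewrite poly_funD poly_fun1 poly_funM ler_norml.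
by apply/andP; split; nra.
Qed.

Definition eval_domfun F : domfun := DomFun (dominated_eval F).

Lemma eval_domfun_linear : linear eval_domfun.
Proof.
move=> c F G; apply/val_inj/funext => a /=.
by rewrite oppoly_evalD oppoly_evalZ.
Qed.

HB.instance Definition _ :=
  GRing.isLinear.Build R (oppoly d H) domfun _ eval_domfun eval_domfun_linear.

Lemma dominated_step (S : set 'rV[R]_d) A :
  (fun a => \1_S a *: A) \in dominated_pred.
Proof.
apply: (dominated_scale (q := 1)) => a; rewrite poly_fun1 indicE.
by case: (a \in S); rewrite ?normr1 ?normr0.
Qed.

Definition step_domfun S A : domfun := DomFun (dominated_step S A).

Lemma step_domfunE S A a : step_domfun S A a = \1_S a *: A. Proof. by []. Qed.

End Dominated.

Section ExtendFunctional.
Context (R : realType) (d : nat) (H : hilbertType R) (X : set 'rV[R]_d).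
Variable L : {scalar oppoly d H}.
Hypothesis Lpos : forall F : oppoly d H,
  (forall a, X a -> psd (oppoly_eval F a)) -> 0 <= L F.

(** [n S A] is the value of a positive extension of [L] at the step function
    [1_S (x) A]. The inequality is all that is used about the extension: signed
    coefficients and suitable [q] turn it into positivity, additivity, and
    comparison with [L] from both sides. *)
Lemma positive_extension : exists n : set 'rV[R]_d -> saop H -> R,
  (forall S, linear_for *%R (n S)) /\
  (forall A (s : seq (R * set 'rV[R]_d)) (q : mpoly d R), psd A ->
     (forall x, X x -> \sum_(t <- s) t.1 * \1_(t.2) x <= poly_fun q x) ->
     \sum_(t <- s) t.1 * n t.2 A <= L (tensor q A)).
Proof.
pose C : set (domfun H X) := [set G | forall a, X a -> psd (G a)].
have [||||f [fL fpos]] := @riesz_extension _ _ _ (@eval_domfun R d H X) C L.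
- by move=> G G' CG CG' a Xa; apply: psdD; [exact: CG|exact: CG'].
- by move=> t G t0 CG a Xa; apply: psdZ => //; exact: CG.
- move=> G; have /asboolP[F FG] := valP G; exists F => a Xa.
  by have [] := FG a Xa.
- by move=> F CF; exact: Lpos.
have fZ c G : f (c *: G) = c * f G by exact: linearZ.
exists (fun S A => f (step_domfun X S A)); split=> [S c A B|A s q pA sq].
  rewrite -fZ -linearD; congr (f _); apply/val_inj/funext => a /=.
  by rewrite !fctE /= scalerDr !scalerA mulrC.
have -> : \sum_(t <- s) t.1 * f (step_domfun X t.2 A) =
    f (\sum_(t <- s) t.1 *: step_domfun X t.2 A).
  by rewrite linear_sum; apply: eq_bigr => t _; rewrite fZ.
rewrite -(fL (tensor q A)) -subr_ge0 -linearB; apply: fpos => a Xa.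
rewrite domfunD domfunN domfun_sum /= oppoly_eval_tensor.
have -> : \sum_(t <- s) (t.1 *: step_domfun X t.2 A) a =
    (\sum_(t <- s) t.1 * \1_(t.2) a) *: A.
  by rewrite scaler_suml; apply: eq_bigr => t _; rewrite domfunZ step_domfunE scalerA.
by rewrite -scalerBl; apply: psdZ => //; rewrite subr_ge0; exact: sq.
Qed.

End ExtendFunctional.

(** * Integration against the regularized measure *)

Section Layers.
Context (R : realType).
Implicit Types (t h : R) (K : nat).

Lemma layers_le t h K : 0 <= t -> 0 < h ->
  \sum_(k < K) h * (k.+1%:R * h <= t)%R%:R <= t.
Proof.
move=> t0 h0; suff : \sum_(k < K) h * (k.+1%:R * h <= t)%R%:R <= Num.min t (K%:R * h).
  by rewrite le_min => /andP[].
elim: K => [|K IH]; first by rewrite big_ord0 mul0r le_min t0 lexx.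
rewrite big_ord_recr /=; move: IH; rewrite !le_min => /andP[IH1 IH2].
have [Kt|tK] := leP (K.+1%:R * h) t; last first.
  by rewrite mulr0 addr0 IH1 (le_trans IH2)// ler_wpM2r ?ler_nat// ltW.
rewrite mulr1; suff : \sum_(i < K) h * (i.+1%:R * h <= t)%R%:R + h <= K.+1%:R * h.
  by move=> H1; rewrite H1 (le_trans H1).
by rewrite -natr1 mulrDl mul1r lerD2r.
Qed.

Lemma le_layers (b : nat -> bool) t h K : 0 < h ->
  (forall k, k%:R * h < t -> b k) ->
  Num.min t (K%:R * h) <= \sum_(k < K) h * (b k)%:R.
Proof.
move=> h0 bP; elim: K => [|K IH]; first by rewrite big_ord0 mul0r ge_min lexx orbT.
rewrite big_ord_recr /=; have [Kt|tK] := ltP (K%:R * h) t.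
  rewrite bP// mulr1 ge_min; apply/orP; right.
  rewrite -natr1 mulrDl mul1r lerD2r; apply: le_trans IH.
  by rewrite le_min lexx ltW.
rewrite ge_min; apply/orP; left; apply: (@le_trans _ _ (Num.min t (K%:R * h))).
  by rewrite le_min lexx.
by apply: le_trans IH _; rewrite lerDl mulr_ge0// ltW.
Qed.

(** Above the height [K h], the bound [t <= t^2 / (K h)] takes over from the layer
    sum. *)
Lemma le_layers_tail (b : nat -> bool) t h K : 0 <= t -> 0 < h -> (0 < K)%N ->
  (forall k, k%:R * h < t -> b k) ->
  t <= \sum_(k < K) h * (b k)%:R + t ^+ 2 / (K%:R * h).
Proof.
move=> t0 h0 K0 bP; have Kh : 0 < K%:R * h by rewrite mulr_gt0// ltr0n.
apply: le_trans (lerD (le_layers K h0 bP) (lexx _)).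
have [tK|Kt] := leP t (K%:R * h).
  by rewrite lerDl divr_ge0 ?sqr_ge0// ltW.
rewrite (le_trans (y := t ^+ 2 / (K%:R * h)))// ?lerDr ?(ltW Kh)//.
by rewrite ler_pdivlMr// expr2 ler_wpM2l// ltW.
Qed.

End Layers.

Lemma indic_setE (R : realType) (T : Type) (b : T -> bool) x :
  \1_[set x | b x] x = (b x)%:R :> R.
Proof. by rewrite indicE; congr (nat_of_bool _)%:R; apply/idP/idP; rewrite inE. Qed.

Section LayerCake.
Local Open Scope ereal_scope.
Context (d : measure_display) (T : measurableType d) (R : realType)
  (mu : {measure set T -> \bar R}) (D : set T) (mD : measurable D) (f : T -> R).
Hypotheses (mf : measurable_fun D f) (f0 : forall x, D x -> (0 <= f x)%R).
Variable h : R.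
Hypothesis h0 : (0 < h)%R.

Lemma measurable_gt_level (a : R) : measurable (D `&` [set x | (a < f x)%R]).
Proof.
have -> : [set x | (a < f x)%R] = f @^-1` `]a, +oo[%classic.
  by apply/seteqP; split=> x /=; rewrite in_itv/= andbT.
exact: mf.
Qed.

Lemma measurable_ge_level (a : R) : measurable (D `&` [set x | (a <= f x)%R]).
Proof.
have -> : [set x | (a <= f x)%R] = f @^-1` `[a, +oo[%classic.
  by apply/seteqP; split=> x /=; rewrite in_itv/= andbT.
exact: mf.
Qed.

Lemma integral_step (S : set T) : measurable S ->
  \int[mu]_(x in D) (h * \1_S x)%:E = h%:E * mu (D `&` S).
Proof.
move=> mS; rewrite (integralZl_indic mD (fun=> S))//; last first.
  by move=> /lt_trans /(_ h0); rewrite ltxx.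
by rewrite integral_indic// setIC.
Qed.

Lemma le_integral_layers (K : nat) :
  \sum_(k < K) h%:E * mu (D `&` [set x | (k.+1%:R * h <= f x)%R]) <=
  \int[mu]_(x in D) (f x)%:E.
Proof.
pose S k := D `&` [set x | (k.+1%:R * h <= f x)%R].
have mS k : measurable (S k) by exact: measurable_ge_level.
have mstep k : measurable_fun D (EFin \o (fun x => h * \1_(S k) x)%R).
  by apply/measurable_EFinP; apply: measurable_funM => //; exact: measurable_indic.
have step0 k x : 0 <= (h * \1_(S k) x)%:E :> \bar R.
  by rewrite lee_fin mulr_ge0// ltW.
have -> : \sum_(k < K) h%:E * mu (D `&` [set x | (k.+1%:R * h <= f x)%R]) =
    \int[mu]_(x in D) \sum_(k < K) (h * \1_(S k) x)%:E.
  rewrite (@ge0_integral_sum _ _ _ mu D mD _ (fun (k : 'I_K) x => (h * \1_(S k) x)%:E))//; last first.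
    by move=> k; exact: mstep.
  apply: eq_bigr => k _.
  by rewrite integral_step// /S setIA setIid.
apply: ge0_le_integral => //.
- by move=> x Dx; apply: sume_ge0.
- by apply: emeasurable_sum => k; exact: mstep.
- exact/measurable_EFinP.
- move=> x Dx; rewrite sumEFin lee_fin.
  apply: le_trans (layers_le K (f0 Dx) h0); apply: ler_sum => k _.
  rewrite ler_pM2l// -(indic_setE R (fun x => (k.+1%:R * h <= f x)%R)).
  by rewrite !indicE /S in_setI; case: (x \in D).
Qed.

Lemma integral_layers_le (c : R) :
  (forall K, \sum_(k < K) h%:E * mu (D `&` [set x | (k%:R * h < f x)%R]) <= c%:E) ->
  \int[mu]_(x in D) (f x)%:E <= c%:E.
Proof.
move=> hc; pose S k := D `&` [set x | (k%:R * h < f x)%R].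
have mS k : measurable (S k) by exact: measurable_gt_level.
have mstep k : measurable_fun D (EFin \o (fun x => h * \1_(S k) x)%R).
  by apply/measurable_EFinP; apply: measurable_funM => //; exact: measurable_indic.
have step0 k x : 0 <= (h * \1_(S k) x)%:E :> \bar R.
  by rewrite lee_fin mulr_ge0// ltW.
apply: (@le_trans _ _ (\int[mu]_(x in D) \sum_(k <oo) (h * \1_(S k) x)%:E)).
  apply: ge0_le_integral => //.
  - exact/measurable_EFinP.
  - by apply: ge0_emeasurable_sum => [k x Dx _|k _]; [exact: step0|exact: mstep].
  - move=> x Dx.
    pose K := Num.bound (f x / h).
    apply: (@le_trans _ _ (\sum_(0 <= k < K) (h * \1_(S k) x)%:E)); last first.
      by apply: nneseries_lim_ge => *; exact: step0.
    rewrite big_mkord sumEFin lee_fin.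
    have -> : (\sum_(k < K) h * \1_(S k) x = \sum_(k < K) h * (k%:R * h < f x)%R%:R)%R.
      apply: eq_bigr => k _; congr (_ * _)%R.
      rewrite -(indic_setE R (fun x => (k%:R * h < f x)%R)) !indicE /S in_setI.
      by rewrite mem_set.
    apply: le_trans (le_layers (b := fun k => (k%:R * h < f x)%R) (t := f x) K h0 _) => //.
    rewrite le_min lexx/= -ler_pdivrMr// ltW//.
    by apply: archi_boundP; rewrite divr_ge0// ?f0// ltW.
rewrite integral_nneseries//.
apply: lime_le.
  by apply: is_cvg_nneseries => k _ _; apply: integral_ge0 => x _; exact: step0.
apply: nearW => K; rewrite big_mkord; apply: le_trans (hc K).
by apply: lee_sum => k _; rewrite integral_step// /S setIA setIid.
Qed.

End LayerCake.

Lemma continuous_measurable (R : realType) (T : normedModType R) (f : T -> R)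
    (D : set (g_sigma_algebraType (@open T))) :
  continuous f -> measurable D ->
  measurable_fun D (f : g_sigma_algebraType (@open T) -> R).
Proof.
move=> /continuousP cf mD.
apply: (measurability _ (RGenOpens.measurableE R)) => _ [_ [a [b ->]] <-].
apply: measurableI => //; apply: sub_sigma_algebra; apply: cf.
exact: interval_open.
Qed.

Section IntegralOuterContent.
Context (R : realType) (T : normedModType R) (n : set T -> R) (X : set T)
  (mu : {measure set (g_sigma_algebraType (@open T)) -> \bar R}).
Hypotheses (nP : finitely_additive n) (cX : closed X) (nX : n (~` X) = 0)
  (muE : forall E, mu E = (outer_content n E)%:E)
  (muT : outer_content n setT = n setT).

Lemma outer_content_setIX E : outer_content n (E `&` X) = outer_content n E.
Proof.
apply/le_anti/andP; split; first by apply: outer_content_mono => //; exact: subIsetl.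
have : outer_content n (~` X) <= 0.
  by rewrite -nX outer_content_le_fadd//; exact: closed_openC.
have h : E `<=` (E `&` X) `|` ~` X.
  by move=> x Ex; have [|] := pselect (X x); [left|right].
have := outer_content_mono nP h; have := outer_contentU nP (E `&` X) (~` X).
lra.
Qed.

Lemma le_outer_content_closed E : closed E -> n E <= outer_content n E.
Proof.
move=> cE; have := outer_content_le_fadd nP (closed_openC cE).
have := outer_contentU nP E (~` E); rewrite setUv muT -{1}(setUv E) nP.2 ?setICr//.
lra.
Qed.

(** The hypotheses say that [l] and [C] behave like the integrals of [f] and
    [f ^ 2] against [n], as far as the comparison with layer sums goes. Open level
    sets are used to bound the integral from above and closed ones to bound it from
    below. The two layer sums differ by the term [k = 0], which is at most [h] times
    the total mass and disappears with [h]. *)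
Lemma integral_outer_content (f : T -> R) (l C : R) : continuous f ->
  (forall x, 0 <= f x) ->
  (forall h K, 0 < h -> \sum_(k < K) h * n [set x | k.+1%:R * h <= f x] <= l) ->
  (forall h K, 0 < h -> (0 < K)%N ->
    l <= \sum_(k < K) h * n [set x | k%:R * h <= f x] + C / (K%:R * h)) ->
  (\int[mu]_(x in (X : set (g_sigma_algebraType (@open T)))) (f x)%:E = l%:E)%E.
Proof.
move=> cf f0 lU lD.
have mX : measurable (X : set (g_sigma_algebraType (@open T))).
  rewrite -[X]setCK; apply: measurableC.
  by apply: sub_sigma_algebra; exact: closed_openC.
have mf := continuous_measurable cf mX.
have l0 : 0 <= l by have := lU 1 0%N ltr01; rewrite big_ord0.
pose M := n setT; have M0 : 0 <= M by exact: fadd_ge0.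
have nM S : n S <= M by exact: fadd_le.
have open_gt a : open [set x | a < f x].
  by apply: (@open_comp _ _ f [set t | a < t]) => // ; exact: open_gt.
have closed_ge a : closed [set x | a <= f x].
  by apply: (@closed_comp _ _ f [set t | a <= t]) => // ; exact: closed_ge.
have up h : 0 < h -> (\int[mu]_(x in (X : set (g_sigma_algebraType (@open T))))
    (f x)%:E <= (h * M + l)%:E)%E.
  move=> h0; apply: (integral_layers_le mX mf _ h0) => [x _|K]; first exact: f0.
  under eq_bigr do rewrite muE -EFinM setIC outer_content_setIX.
  rewrite sumEFin lee_fin; case: K => [|K].
    by rewrite big_ord0 addr_ge0// mulr_ge0// ltW.
  rewrite big_ord_recl /=; apply: lerD.
    by rewrite ler_pM2l// (le_trans (outer_content_le_fadd nP _)).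
  apply: le_trans (lU h K h0); apply: ler_sum => k _; rewrite ler_pM2l//.
  apply: le_trans (outer_content_le_fadd nP (open_gt _)) _.
  by apply: fadd_le => // x /= /ltW.
have upl : (\int[mu]_(x in (X : set (g_sigma_algebraType (@open T)))) (f x)%:E <=
    l%:E)%E.
  apply/lee_addgt0Pr => e e0.
  have M1 : 0 < M + 1 by rewrite ltr_wpDl.
  apply: le_trans (up (e / (M + 1)) _) _; first by rewrite divr_gt0.
  rewrite -EFinD lee_fin addrC lerD2l -mulrA ger_pMr// mulrC ler_pdivrMr// mul1r.
  by rewrite lerDl.
apply/le_anti/andP; split => //.
have I0 : (0 <= \int[mu]_(x in (X : set (g_sigma_algebraType (@open T)))) (f x)%:E)%E.
  by apply: integral_ge0 => x _; rewrite lee_fin.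
have lay h K : 0 < h ->
    ((\sum_(k < K) h * outer_content n [set x | (k.+1%:R * h <= f x)%R])%:E <=
    \int[mu]_(x in (X : set (g_sigma_algebraType (@open T)))) (f x)%:E)%E.
  move=> h0; have := le_integral_layers mu mX mf (fun x _ => f0 x) h0 K.
  under eq_bigr do rewrite muE -EFinM setIC outer_content_setIX.
  by rewrite sumEFin.
case: (\int[mu]_(x in _) _)%E upl I0 lay => [I||]// _ _ lay.
rewrite lee_fin.
have step h : 0 < h -> l - I <= h * M.
  move=> h0; rewrite -subr_le0; apply: (le0_of_vanishing (C := C / h) cvg_harmonic) => K.
  rewrite /harmonic /=.
  have := lD h K.+1 h0 isT; rewrite big_ord_recl /= mul0r.
  have : \sum_(i < K) h * n [set x | (bump 0 i)%:R * h <= f x] <= I.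
    rewrite -lee_fin; apply: le_trans (lay h K h0); rewrite lee_fin.
    apply: ler_sum => k _; rewrite ler_pM2l//.
    exact: le_outer_content_closed.
  have : h * n [set x | 0 <= f x] <= h * M by rewrite ler_pM2l.
  have -> : C / (K.+1%:R * h) = C / h / K.+1%:R by rewrite invfM mulrA mulrAC.
  move: (h * n _) (\sum_(i < K) _) (h * M) (C / h / _) => a b c e; lra.
rewrite -subr_le0; apply: (le0_of_vanishing (C := M) cvg_harmonic) => k.
by rewrite mulrC; apply: step; rewrite /harmonic /= invr_gt0.
Qed.

End IntegralOuterContent.

(** * Operator-valued measures from positive functionals *)

Section PolyFun.
Context (R : realType) (d : nat).

Lemma poly_fun_continuous (p : mpoly d R) : continuous (poly_fun p : 'rV[R]_d -> R).
Proof.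
have -> : poly_fun p = fun a => \sum_(m <- mpoly.msupp p)
    mpoly.mcoeff m p * \prod_(i <- index_enum 'I_d) a ord0 i ^+ (m i).
  by apply/funext => a; rewrite /poly_fun mevalE.
apply: continuous_big => [|m _ a]; first exact: add_continuous.
have cprod : continuous (fun b : 'rV[R]_d => \prod_i b ord0 i ^+ m i).
  apply: continuous_big => [|i _ b]; first exact: mul_continuous.
  apply: (@continuous_comp _ _ _ (fun c : 'rV[R]_d => c ord0 i) (fun t => t ^+ m i)).
    exact: coord_continuous.
  exact: exprn_continuous.
by apply: continuousM; [exact: cst_continuous|exact: cprod].
Qed.

(** The polynomial [|x|^2], whose sublevel sets are compact. *)
Definition sqnorm_poly : mpoly d R :=
  \sum_(i < d) mpolyX R (mnm1 i) * mpolyX R (mnm1 i).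

Lemma sqnorm_polyE (a : 'rV[R]_d) : poly_fun sqnorm_poly a = \sum_(i < d) a ord0 i ^+ 2.
Proof.
rewrite /poly_fun raddf_sum; apply: eq_bigr => i _.
by rewrite /= mevalM mevalXU expr2.
Qed.

Lemma sqnorm_poly_compact (N : R) : 0 < N ->
  compact [set a : 'rV[R]_d | poly_fun sqnorm_poly a <= N].
Proof.
move=> N0; apply: bounded_closed_compact; last first.
  apply: (@closed_comp _ _ (poly_fun sqnorm_poly : 'rV[R]_d -> R) [set t | t <= N]).
    by move=> a _; exact: poly_fun_continuous.
  exact: closed_le.
exists (N + 1); split; first exact: num_real.
move=> M NM a /= aN; apply: le_trans (ltW NM).
have N10 : 0 <= N + 1 by rewrite addr_ge0// ltW.
have -> : `|a| = mx_norm a by [].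
rewrite mx_normrE; apply/bigmax_leP; split=> // -[i j] _ /=.
rewrite (ord1 i); have h : a ord0 j ^+ 2 <= N.
  apply: le_trans aN; rewrite sqnorm_polyE (bigD1 j)//= lerDl.
  by apply: sumr_ge0 => k _; exact: sqr_ge0.
rewrite -(ler_pXn2r (n := 2))// ?nnegrE// real_normK ?num_real//.
by apply: le_trans h _; nra.
Qed.

End PolyFun.

Section PositiveParts.
Context (R : realType) (H : hilbertType R).
Implicit Types A B P N : saop H.

Lemma pospart_negpartP A : posneg_parts A (pospart A, negpart A).
Proof.
rewrite /pospart /negpart -surjective_pairing.
by case: xgetP => [PN -> //|/(_ _)]; have [PN] := posneg_parts_exist A => + /(_ PN).
Qed.

Lemma psd_pospart A : psd (pospart A). Proof. by have [] := pospart_negpartP A. Qed.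
Lemma psd_negpart A : psd (negpart A). Proof. by have [] := pospart_negpartP A. Qed.
Lemma pospartB A : A = pospart A - negpart A.
Proof. by have [_ _] := pospart_negpartP A. Qed.

(** The value [phi P - phi N] at [P - N] depends on the difference only, which
    gives linearity. Boundedness is automatic: [A] lies between the multiples of the
    identity by [- opnorm A] and [opnorm A]. *)
Lemma cone_functional (phi : saop H -> R) :
  (forall A, psd A -> 0 <= phi A) ->
  (forall (s t : R) A B, 0 <= s -> 0 <= t -> psd A -> psd B ->
     phi (s *: A + t *: B) = s * phi A + t * phi B) ->
  exists f : bounded_functional H, forall A, psd A -> f A = phi A.
Proof.
move=> phi0 phiL.
have phiD A B : psd A -> psd B -> phi (A + B) = phi A + phi B.
  by move=> pA pB; have := phiL 1 1 A B ler01 ler01 pA pB; rewrite !scale1r !mul1r.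
have phiZ (s : R) A : 0 <= s -> psd A -> phi (s *: A) = s * phi A.
  move=> s0 pA; have := phiL s 0 A A s0 (lexx _) pA pA.
  by rewrite scale0r addr0 mul0r addr0.
pose g A := phi (pospart A) - phi (negpart A).
have gE A P N : psd P -> psd N -> A = P - N -> g A = phi P - phi N.
  move=> pP pN AE; have : pospart A + N = P + negpart A.
    have -> : pospart A = A + negpart A by apply/eqP; rewrite -subr_eq -pospartB.
    have -> : P = A + N by rewrite AE subrK.
    by rewrite addrAC.
  move=> /(congr1 phi); rewrite !phiD//; rewrite /g; try exact: psd_pospart; try exact: psd_negpart.
  lra.
have gl : linear_for *%R g.
  move=> c A B.
  have [c0|c0] := leP 0 c.
    rewrite (@gE _ (c *: pospart A + pospart B) (c *: negpart A + negpart B)).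
    - rewrite !phiD ?phiZ//; try exact: psd_pospart; try exact: psd_negpart;
        try (apply: psdZ => //; (exact: psd_pospart || exact: psd_negpart)).
      rewrite /g; lra.
    - by apply: psdD; [apply: psdZ => //|]; exact: psd_pospart.
    - by apply: psdD; [apply: psdZ => //|]; exact: psd_negpart.
    - by rewrite opprD addrACA -scalerBr -!pospartB.
  have c0' : 0 <= - c by rewrite oppr_ge0 ltW.
  rewrite (@gE _ (- c *: negpart A + pospart B) (- c *: pospart A + negpart B)).
  - rewrite !phiD ?phiZ//; try exact: psd_pospart; try exact: psd_negpart;
        try (apply: psdZ => //; (exact: psd_pospart || exact: psd_negpart)).
    rewrite /g; lra.
  - by apply: psdD; [apply: psdZ => //; exact: psd_negpart|exact: psd_pospart].
  - by apply: psdD; [apply: psdZ => //; exact: psd_pospart|exact: psd_negpart].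
  - by rewrite opprD addrACA -scalerBr -opprB scaleNr scalerN opprK -!pospartB.
pose gL := GRing.isLinear.Build _ _ _ _ g gl.
pose gf : {scalar saop H} := HB.pack g gL.
have gphi A : psd A -> gf A = phi A.
  move=> pA; rewrite -[gf A]/(g A) (@gE A A 0) ?subr0//; last exact: psd0.
  by rewrite -(scale0r 0) phiZ ?mul0r ?subr0//; exact: psd0.
have gbound : exists M : R, forall A, `|gf A| <= M * opnorm A.
  exists (gf (idop H)) => A.
  have gfZ (c : R) B : gf (c *: B) = c * gf B by exact: linearZ.
  have := phi0 _ (psd_opnormB A); have := phi0 _ (psd_opnormD A).
  rewrite -!gphi; try exact: psd_opnormB; try exact: psd_opnormD.
  by rewrite linearB linearD gfZ ler_norml; lra.
by exists (BoundedFunctional gbound).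
Qed.

End PositiveParts.

Section ContentOfExtension.
Context (R : realType) (d : nat) (H : hilbertType R) (X : set 'rV[R]_d).
Variables (L : {scalar oppoly d H}) (n : set 'rV[R]_d -> saop H -> R).
Hypothesis cX : closed X.
Hypothesis nlin : forall S, linear_for *%R (n S).
Hypothesis nle : forall A (s : seq (R * set 'rV[R]_d)) (q : mpoly d R), psd A ->
  (forall x, X x -> \sum_(t <- s) t.1 * \1_(t.2) x <= poly_fun q x) ->
  \sum_(t <- s) t.1 * n t.2 A <= L (tensor q A).
Implicit Types (A B : saop H) (S : set 'rV[R]_d) (p q : mpoly d R).

Lemma functional_tensorZ (c : R) q A : L (tensor (c *: q) A) = c * L (tensor q A).
Proof. by rewrite tensorZl; exact: linearZ. Qed.

Lemma functional_tensorB p q A : L (tensor (p - q) A) = L (tensor p A) - L (tensor q A).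
Proof. by rewrite tensorBl linearB. Qed.

Lemma functional_tensor0 A : L (tensor 0 A) = 0.
Proof. by rewrite -(scale0r 1) functional_tensorZ mul0r. Qed.

Lemma content_layers A (c : R) (K : nat) (S : nat -> set 'rV[R]_d) q : psd A ->
  (forall x, X x -> \sum_(k < K) c * \1_(S k) x <= poly_fun q x) ->
  \sum_(k < K) c * n (S k) A <= L (tensor q A).
Proof.
move=> pA h; have := @nle A [seq (c, S k) | k <- index_iota 0 K] q pA.
rewrite !big_map big_mkord; apply=> x Xx; rewrite big_map big_mkord; exact: h.
Qed.

Lemma content_finitely_additive A : psd A -> finitely_additive (n^~ A).
Proof.
move=> pA; split=> [S|S S' SS'].
  have := @nle A [:: (-1, S)] 0 pA; rewrite !big_seq1 /= functional_tensor0.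
  rewrite mulN1r oppr_le0; apply=> x _; rewrite big_seq1 poly_fun0 /= mulN1r.
  by rewrite oppr_le0 indicE.
have indU x : \1_(S `|` S') x = \1_S x + \1_S' x :> R.
  rewrite !indicE in_setU; have [xS|] := boolP (x \in S); last by rewrite add0r.
  have [xS'|] := boolP (x \in S'); last by rewrite addr0.
  have : (S `&` S') x by move: xS xS'; rewrite !inE.
  by rewrite SS'.
have sum3 (a b c : R * set 'rV[R]_d) (F : R * set 'rV[R]_d -> R) :
    \sum_(t <- [:: a; b; c]) F t = F a + (F b + F c).
  by rewrite !big_cons big_nil addr0.
apply/le_anti/andP; split.
  have := @nle A [:: (1, S `|` S'); (-1, S); (-1, S')] 0 pA.
  rewrite sum3 /= functional_tensor0 => h.
  suff : 1 * n (S `|` S') A + (-1 * n S A + -1 * n S' A) <= 0 by lra.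
  by apply: h => x _; rewrite sum3 /= indU poly_fun0; lra.
have := @nle A [:: (-1, S `|` S'); (1, S); (1, S')] 0 pA.
rewrite sum3 /= functional_tensor0 => h.
suff : -1 * n (S `|` S') A + (1 * n S A + 1 * n S' A) <= 0 by lra.
by apply: h => x _; rewrite sum3 /= indU poly_fun0; lra.
Qed.

Lemma content_setC A : psd A -> n (~` X) A = 0.
Proof.
move=> pA; apply/le_anti; rewrite (fadd_ge0 (content_finitely_additive pA)) andbT.
have := @nle A [:: (1, ~` X)] 0 pA; rewrite !big_seq1 /= functional_tensor0 mul1r.
apply=> x Xx; rewrite big_seq1 /= mul1r poly_fun0 indicE memNset ?lexx//; exact.
Qed.

(** Chebyshev's inequality for the polynomial [|x|^2]. *)
Lemma content_tight A : psd A ->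
  forall e : R, 0 < e -> exists K, compact K /\ n (~` K) A <= e.
Proof.
move=> pA e e0; pose q := sqnorm_poly R d; pose l := L (tensor q A).
(* Chebyshev's bound [l / N] is at most [e] for this [N]. *)
pose N := `|l| / e + 1; have N0 : 0 < N by rewrite ltr_wpDl// divr_ge0// ltW.
exists [set a | poly_fun q a <= N]; split; first exact: sqnorm_poly_compact.
apply: (@le_trans _ _ (N^-1 * l)); last first.
  rewrite mulrC ler_pdivrMr// /N mulrDr mulr1 mulrC divfK ?gt_eqF//.
  by rewrite (le_trans (ler_norm _))// lerDl ltW.
have := @nle A [:: (1, ~` [set a | poly_fun q a <= N])] (N^-1 *: q) pA.
rewrite !big_seq1 /= mul1r functional_tensorZ; apply=> x _.
rewrite big_seq1 /= mul1r poly_funZ indicE mulrC.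
have q0 : 0 <= poly_fun q x.
  by rewrite sqnorm_polyE; apply: sumr_ge0 => i _; exact: sqr_ge0.
have [qN|Nq] := leP (poly_fun q x) N.
  by rewrite memNset ?divr_ge0// ?(ltW N0)// => /(_ qN).
rewrite mem_set /=; last by rewrite leNgt Nq.
by rewrite ler_pdivlMr// mul1r ltW.
Qed.

Lemma outer_content_linear A B (s t : R) (E : set 'rV[R]_d) :
  0 <= s -> 0 <= t -> psd A -> psd B ->
  outer_content (n^~ (s *: A + t *: B)) E =
  s * outer_content (n^~ A) E + t * outer_content (n^~ B) E.
Proof.
move=> s0 t0 pA pB; apply: outer_content_comb => //.
- by apply: content_finitely_additive; apply: psdD; exact: psdZ.
- exact: content_finitely_additive.
- exact: content_finitely_additive.
- move=> S; rewrite nlin; congr (_ + _).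
  have n0 : n S 0 = 0.
    by have := nlin S 1 0 0; rewrite scale1r addr0 mul1r; lra.
  by have := nlin S t B 0; rewrite !addr0 n0 addr0.
Qed.

Section FixedOperator.
Variables (A : saop H) (pA : psd A)
  (mu : {measure set (borelRd R d) -> \bar R}).
Hypothesis muE : forall E, mu E = (outer_content (n^~ A) E)%:E.

Lemma integral_square q :
  (\int[mu]_(x in (X : set (borelRd R d))) (poly_fun (q * q) x)%:E =
   (L (tensor (q * q) A))%:E)%E.
Proof.
have q0 x : 0 <= poly_fun (q * q) x by rewrite poly_funM -expr2 sqr_ge0.
have nP := content_finitely_additive pA.
apply: (integral_outer_content (n := n^~ A) nP cX (content_setC pA) muE
  (outer_content_setT nP (content_tight pA)) (C := L (tensor ((q * q) * (q * q)) A))).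
- exact: poly_fun_continuous.
- exact: q0.
- move=> h K h0.
  apply: (content_layers (S := fun k => [set x | k.+1%:R * h <= poly_fun (q * q) x]) pA).
  move=> x _.
  apply: le_trans (layers_le K (q0 x) h0); apply: ler_sum => k _.
  by rewrite (indic_setE R (fun x => k.+1%:R * h <= poly_fun (q * q) x)).
- move=> h K h0 K0.
  have := @content_layers A (- h) K (fun k => [set x | k%:R * h <= poly_fun (q * q) x])
    ((K%:R * h)^-1 *: ((q * q) * (q * q)) - q * q) pA.
  have sumN (F : nat -> R) : \sum_(k < K) - h * F k = - \sum_(k < K) h * F k.
    by rewrite -sumrN; apply: eq_bigr => k _; rewrite mulNr.
  rewrite functional_tensorB functional_tensorZ.
  rewrite (sumN (fun k => n [set x | k%:R * h <= poly_fun (q * q) x] A)) => H1.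
  have flip (s c a b : R) : - s <= c * b - a -> a <= s + b * c.
    by rewrite (mulrC b); lra.
  have flip' (s c a : R) : a <= s + a ^+ 2 * c -> - s <= c * (a * a) - a.
    by rewrite (mulrC c) -expr2; lra.
  apply: flip; apply: H1 => x _; rewrite poly_funB poly_funZ [in X in X - _]poly_funM.
  rewrite (sumN (fun k => \1_[set x | k%:R * h <= poly_fun (q * q) x] x)).
  apply: flip'; apply: le_trans
    (le_layers_tail (b := fun k => k%:R * h <= poly_fun (q * q) x) (q0 x) h0 K0 _) _;
    last first.
    rewrite lerD2r; apply: ler_sum => k _.
    by rewrite (indic_setE R (fun x => k%:R * h <= poly_fun (q * q) x)).
  by move=> k /ltW.
Qed.

Lemma integrable_square q :
  mu.-integrable (X : set (borelRd R d)) (EFin \o poly_fun (q * q)).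
Proof.
apply/integrableP; split.
  have mX : measurable (X : set (borelRd R d)) by exact: Defs.closed_measurable.
  apply/measurable_EFinP.
  exact (continuous_measurable (@poly_fun_continuous R d (q * q)) mX).
rewrite (_ : (\int[mu]_(x in _) _)%E = (L (tensor (q * q) A))%:E) ?ltry//.
rewrite -integral_square; apply: eq_integral => x _ /=.
by rewrite ger0_norm// poly_funM -expr2 sqr_ge0.
Qed.

(** Both sides are linear, and [p] is a difference of two squares. *)
Lemma integral_poly p :
  mu.-integrable (X : set (borelRd R d)) (EFin \o poly_fun p) /\
  (\int[mu]_(x in (X : set (borelRd R d))) (poly_fun p x)%:E = (L (tensor p A))%:E)%E.
Proof.
have mX : measurable (X : set (borelRd R d)) by exact: Defs.closed_measurable.
have [q pE] := poly_polarization p.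
have fE : EFin \o poly_fun p =
    (fun x => (poly_fun ((q + 1) * (q + 1)) x)%:E - (poly_fun (q * q) x)%:E)%E.
  by apply/funext => x; rewrite /= {1}pE poly_funB.
split.
  by rewrite fE; apply: integrableB => //; exact: integrable_square.
rewrite -[LHS]/(integral mu _ (EFin \o poly_fun p)) fE.
rewrite integralB_EFin//; try exact: integrable_square.
by rewrite !integral_square -EFinB -functional_tensorB -pE.
Qed.

End FixedOperator.
End ContentOfExtension.

(** The functional [m D] is obtained from [A |-> outer_content (n^~ A) D] for each
    set [D], measurable or not, since the regularization is linear in [A] on all
    sets. *)
Lemma measure_of_positive_functional (R : realType) (H : hilbertType R) (d : nat)
    (X : set (borelRd R d)) (hX : closed (X : set 'rV[R]_d))
    (L : {scalar oppoly d H}) :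
  (forall F : oppoly d H,
     (forall a : 'rV[R]_d, X a -> psd (oppoly_eval F a)) -> 0 <= L F) ->
  exists m : set (borelRd R d) -> bounded_functional H,
    [/\ nonneg_opmeasure X m,
        forall p : mpoly d R, opintegrable X m (poly_fun p)
      & forall s : seq (mpoly d R * saop H),
          L (\sum_(t <- s) tensor t.1 t.2) =
          \sum_(t <- s) opintegral X m (poly_fun t.1) t.2].
Proof.
move=> /positive_extension[n [nlin nle]].
have nP A : psd A -> finitely_additive (n^~ A).
  exact: (content_finitely_additive nle).
have /choice[m mE] : forall D : set (borelRd R d), exists f : bounded_functional H,
    forall A, psd A -> f A = outer_content (n^~ A) (D : set 'rV[R]_d).
  move=> D; apply: cone_functional.
  - by move=> A pA; apply: outer_content_ge0; exact: nP.
  - by move=> s t A B *; exact: (outer_content_linear nlin nle).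
have muE A : psd A -> exists mu : {measure set (borelRd R d) -> \bar R},
    (forall E, mu E = (outer_content (n^~ A) E)%:E) /\
    (opmeasure_at X m A = mu :> (set (borelRd R d) -> \bar R)).
  move=> pA; have [mu muE] := outer_content_measure (nP A pA).
  exists mu; split=> //; apply/funext => D; rewrite /opmeasure_at mE// muE.
  congr (_%:E); apply: outer_content_setIX; first exact: nP.
  - exact: hX.
  - exact: (content_setC nle).
exists m; split.
- move=> A pA; have [mu [muA _]] := muE A pA.
  have EE D : m D A = outer_content (n^~ A) D by exact: mE.
  split.
  + by move=> D _; rewrite EE; apply: outer_content_ge0; exact: nP.
  + move=> D1 D2 [mD1 _] [mD2 _] D12; rewrite !EE; apply: EFin_inj.
    by rewrite EFinD -!muA measureU.
  + move=> D mD DS; rewrite EE.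
    have mono E E' : E `<=` E' -> m E A <= m E' A.
      by move=> EE'; rewrite !EE; apply: outer_content_mono => //; exact: nP.
    have c0 : (fun i => (m (D i) A)%:E) @ \oo -->
        (outer_content (n^~ A) (\bigcup_i D i))%:E.
      under eq_fun do rewrite EE -muA; rewrite -muA.
      apply: nondecreasing_cvg_mu.
      - by move=> i; have [] := mD i.
      - by apply: bigcup_measurable => i _; have [] := mD i.
      - by apply/nondecreasing_seqP => i; apply/subsetPset; exact: DS.
    have c1 : (fun i => m (D i) A) @ \oo --> sup [set m (D i) A | i in [set: nat]].
      apply: nondecreasing_cvgn.
        by apply/nondecreasing_seqP => i; exact: mono.
      by exists (m (\bigcup_i D i) A) => _ [i _ <-]; apply: mono; exact: bigcup_sup.
    have c2 : (fun i => m (D i) A) @ \oo --> outer_content (n^~ A) (\bigcup_i D i).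
      exact: (fine_cvg c0).
    by rewrite -(cvg_lim _ c2)// (cvg_lim _ c1).
- move=> p A pA; have [mu [muA ->]] := muE A pA.
  by have [] := integral_poly hX nle pA muA p.
- have opE p A : psd A -> opintegral_psd X m (poly_fun p) A = L (tensor p A).
    move=> pA; rewrite /opintegral_psd; have [mu [muA ->]] := muE A pA.
    by have [_ ->] := integral_poly hX nle pA muA p.
  move=> s; rewrite linear_sum; apply: eq_bigr => t _.
  rewrite /opintegral !opE; try exact: psd_pospart; try exact: psd_negpart.
  by rewrite -linearB /= -tensorBr -pospartB.
Qed.

(** * Positivity of integrals against operator-valued measures *)

Section RawIntegral.
Context (disp : measure_display) (T : measurableType disp) (R : realType).
Implicit Types (f g : set T -> \bar R) (h : T -> \bar R) (D : set T).
Import HBNNSimple.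

(** Set functions such as [opmeasure_at X m A] behave like measures on measurable
    sets only, so they are not measures as functions on all sets; their integrals
    are compared with those of true measures here. *)
Lemma eq_setfun_integral f g h D : (forall S, measurable S -> f S = g S) ->
  integral f D h = integral g D h.
Proof.
move=> fg; have sE (k : {nnsfun T >-> R}) : sintegral f k = sintegral g k.
  by apply: eq_fsbigr => r _; rewrite fg.
have imE (P : set {nnsfun T >-> R}) :
    [set sintegral f k | k in P] = [set sintegral g k | k in P].
  by apply/seteqP; split=> _ [k Pk <-]; exists k; rewrite ?sE.
by rewrite /integral !imE.
Qed.

Lemma eq_setfun_integrable f g h D : (forall S, measurable S -> f S = g S) ->
  f.-integrable D h -> g.-integrable D h.
Proof.
move=> fg /integrableP[mh fh]; apply/integrableP; split=> //.
by rewrite -(eq_setfun_integral _ _ fg).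
Qed.

End RawIntegral.

Section PositiveMeasure.
Context (disp : measure_display) (T : measurableType disp) (R : realType).
Variables (X : set T) (E : set T -> R).
Hypotheses (mX : measurable X) (EP : positive_measure X E).

Lemma positive_measure_set0 : E set0 = 0.
Proof.
have s0 : sigma_on X (set0 : set T) by split; [exact: measurable0|exact: sub0set].
have [_ ED _] := EP; have := ED set0 set0 s0 s0 (setI0 _); rewrite setU0; lra.
Qed.

Lemma positive_measure_le D1 D2 : sigma_on X D1 -> sigma_on X D2 ->
  D1 `<=` D2 -> E D1 <= E D2.
Proof.
move=> [mD1 D1X] [mD2 D2X] D12; have [E0 ED _] := EP.
have s : sigma_on X (D2 `\` D1).
  by split; [exact: measurableD|exact: subset_trans (@subDsetl _ _ _) D2X].
rewrite -(setDUK D12) ED ?lerDl ?E0//.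
by rewrite setDE setICA setICr setI0.
Qed.

Lemma positive_measure_bigsetU (F : nat -> set T) n :
  (forall i, sigma_on X (F i)) -> trivIset setT F ->
  E (\big[setU/set0]_(i < n) F i) = \sum_(i < n) E (F i).
Proof.
move=> sF tF; have [_ ED _] := EP.
elim: n => [|n IH]; first by rewrite !big_ord0 positive_measure_set0.
rewrite !big_ord_recr /= ED ?IH//.
- split; first by apply: bigsetU_measurable => i _; have [] := sF i.
  by rewrite -bigcup_mkord; apply: bigcup_sub => i _; have [] := sF i.
- by apply: (@trivIset_bigsetUI _ predT) => //; rewrite /predT /= trueE.
Qed.

Lemma positive_measure_measure : exists mu : {measure set T -> \bar R},
  forall D, measurable D -> mu D = (E (D `&` X))%:E.
Proof.
have [E0 ED Esup] := EP.
(* Off the measurable sets [E] may be negative, which a measure may not be. *)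
pose f (D : set T) : \bar R := if `[< measurable D >] then (E (D `&` X))%:E else 0%E.
have fE D : measurable D -> f D = (E (D `&` X))%:E.
  by move=> mD; rewrite /f asboolT.
have sI D : measurable D -> sigma_on X (D `&` X).
  by move=> mD; split; [exact: measurableI|exact: subIsetr].
have f0 : f set0 = 0%E.
  by rewrite fE ?set0I ?positive_measure_set0//; exact: measurable0.
have fge0 D : (0 <= f D)%E.
  by rewrite /f; case: asboolP => // mD; rewrite lee_fin E0//; exact: sI.
have fadd : semi_sigma_additive f.
  move=> F mF tF mUF; rewrite fE// setI_bigcupl.
  have tFX : trivIset setT (fun i => F i `&` X).
    by apply: trivIset_setIr.
  pose G n := \big[setU/set0]_(i < n) (F i `&` X).
  have sG n : sigma_on X (G n).
    split; first by apply: bigsetU_measurable => i _; have [] := sI _ (mF i).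
    rewrite /G -(bigcup_mkord n (fun i => F i `&` X)).
    by apply: bigcup_sub => i _; exact: subIsetr.
  have GS n : G n `<=` G n.+1.
    by rewrite /G big_ord_recr /=; exact: subsetUl.
  have -> : (fun n => \sum_(0 <= i < n) f (F i))%E = EFin \o (fun n => E (G n)).
    apply/funext => n /=; rewrite big_mkord.
    rewrite /G (@positive_measure_bigsetU (fun i => F i `&` X))//; last first.
      by move=> i; exact: sI.
    by rewrite -sumEFin; apply: eq_bigr => i _; rewrite fE.
  have -> : \bigcup_n (F n `&` X) = \bigcup_n G n.
    apply/seteqP; split=> x [n _ Fx].
      by exists n.+1 => //; rewrite /G big_ord_recr /=; right.
    move: Fx; rewrite /G -(bigcup_mkord n (fun i => F i `&` X)) => -[i _ Fix].
    by exists i.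
  rewrite Esup//; apply: cvg_EFin; first exact: nearW.
  apply: nondecreasing_cvgn.
    by apply/nondecreasing_seqP => n; exact: positive_measure_le.
  exists (E X) => _ [n _ <-] /=.
  by apply: positive_measure_le; [exact: sG|split|have [] := sG n].
pose fM := isMeasure.Build _ T R f f0 fge0 fadd.
by exists (HB.pack f fM : {measure set T -> \bar R}).
Qed.

End PositiveMeasure.

Section CompareIntegrals.
Local Open Scope ereal_scope.
Context (disp : measure_display) (T : measurableType disp) (R : realType)
  (X : set T) (mX : measurable X) (I : finType)
  (mu nu : I -> {measure set T -> \bar R}) (f : I -> T -> R).
Hypotheses (mf : forall i, measurable_fun X (f i))
  (f0 : forall i x, X x -> (0 <= f i x)%R)
  (muX : forall i, mu i X < +oo) (nuX : forall i, nu i X < +oo).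
Hypothesis munu : forall D a, measurable D -> D `<=` X -> D a ->
  \sum_i (f i a)%:E * nu i D <= \sum_i (f i a)%:E * mu i D.

Section Mesh.
Variable e : R.
Hypothesis e0 : (0 < e)%R.

(** A countable partition of [X] is indexed by the integer parts of the [f i / e],
    encoded as one natural number. *)
Definition mesh_code (x : T) : {ffun I -> nat} :=
  [ffun i => Num.truncn (f i x / e)%R].

Definition mesh_cell (k : nat) := X `&` [set x | choice.pickle (mesh_code x) = k].

Lemma mesh_cell_close k x y i : mesh_cell k x -> mesh_cell k y ->
  (f i x <= f i y + e)%R.
Proof.
move=> [Xx <-] [Xy /(pcan_inj (@choice.pickleK _))/ffunP/(_ i)]; rewrite !ffunE => xy.
have fe0 z : X z -> (0 <= f i z / e)%R by move=> Xz; rewrite divr_ge0 ?f0// ltW.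
have /andP[_ h1] := truncn_itv (fe0 x Xx).
have /andP[h2 _] := truncn_itv (fe0 y Xy).
have h : (f i x / e <= f i y / e + 1)%R.
  by rewrite (le_trans (ltW h1))// -xy -natr1 lerD2r.
by move: h; rewrite -(ler_pM2r e0) mulrDl mul1r !divfK// gt_eqF.
Qed.

Lemma measurable_mesh_cell k : measurable (mesh_cell k).
Proof.
have [->|/set0P[x [Xx xk]]] := eqVneq (mesh_cell k) set0; first exact: measurable0.
have -> : mesh_cell k = \big[setI/X]_(i <- index_enum I)
    (X `&` [set y | Num.truncn (f i y / e)%R = Num.truncn (f i x / e)%R]).
  apply/seteqP; split=> y.
    move=> [Xy yk]; elim/big_ind : _ => // i _; split=> //=.
    move: yk; rewrite /= -xk => /(pcan_inj (@choice.pickleK _))/ffunP/(_ i).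
    by rewrite !ffunE.
  move=> yI; have yi i : X y /\ Num.truncn (f i y / e)%R = Num.truncn (f i x / e)%R.
    by move: yI; rewrite (bigD1_seq i) ?mem_index_enum ?index_enum_uniq//= => -[].
  split.
    move: yI; elim/big_rec : _ => // i B _ IH [_ /IH] //.
  by rewrite /= -xk; congr choice.pickle; apply/ffunP => i; rewrite !ffunE; have [] := yi i.
elim/big_ind : _ => // [A B mA mB|i _]; first exact: measurableI.
set j := Num.truncn _.
have -> : X `&` [set y | Num.truncn (f i y / e)%R = j] =
    X `&` (f i @^-1` `[(j%:R * e)%R, (j.+1%:R * e)%R[%classic).
  apply/seteqP; split=> y [Xy] /= h; split=> //.
    have := truncn_itv (x := (f i y / e)%R); rewrite h divr_ge0 ?f0// ?(ltW e0)//.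
    by move=> /(_ isT); rewrite in_itv/= ler_pdivlMr// ltr_pdivrMr.
  by apply: truncn_def; move: h; rewrite in_itv/= ler_pdivlMr// ltr_pdivrMr.
exact: mf.
Qed.

Lemma mesh_cell_bigcup : \bigcup_k mesh_cell k = X.
Proof.
apply/seteqP; split=> x; first by move=> [k _ []].
by move=> Xx; exists (choice.pickle (mesh_code x)).
Qed.

Lemma mesh_cell_trivIset : trivIset setT mesh_cell.
Proof. by move=> k l _ _ [x [[_ <-] [_ <-]]]. Qed.

Lemma mesh_compare k :
  \sum_i \int[nu i]_(x in mesh_cell k) (f i x)%:E <=
  \sum_i (\int[mu i]_(x in mesh_cell k) (f i x + e)%:E +
          \int[nu i]_(x in mesh_cell k) e%:E).
Proof.
have [->|/set0P[a ka]] := eqVneq (mesh_cell k) set0.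
  by rewrite !big1// => i _; rewrite !integral_set0 ?adde0.
have mk := measurable_mesh_cell k.
have kX : mesh_cell k `<=` X by exact: subIsetl.
have mfk i : measurable_fun (mesh_cell k) (f i) by exact: measurable_funS (mf i).
have fk0 i x : mesh_cell k x -> (0 <= f i x)%R by move=> [Xx _]; exact: f0.
apply: (@le_trans _ _ (\sum_i ((f i a)%:E * nu i (mesh_cell k) + e%:E * nu i (mesh_cell k)))).
  apply: lee_sum => i _; rewrite -ge0_muleDl ?lee_fin ?(ltW e0) ?(fk0 i a)//.
  rewrite -EFinD -integral_cst//; apply: ge0_le_integral => //.
  - by move=> x kx; rewrite lee_fin fk0.
  - exact/measurable_EFinP.
  - by move=> x kx; rewrite lee_fin; exact: mesh_cell_close ka.
rewrite [leLHS]big_split [leRHS]big_split /=; apply: leeD; last first.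
  by apply: lee_sum => i _; rewrite integral_cst.
apply: le_trans (munu mk kX ka) _; apply: lee_sum => i _.
rewrite -integral_cst//; apply: ge0_le_integral => //.
- by move=> x kx; rewrite lee_fin fk0.
- by apply/measurable_EFinP; apply: measurable_funD.
- by move=> x kx; rewrite lee_fin; exact: (mesh_cell_close i ka kx).
Qed.

Lemma compare_integrals_mesh :
  \sum_i \int[nu i]_(x in X) (f i x)%:E <=
  \sum_i (\int[mu i]_(x in X) (f i x + e)%:E + \int[nu i]_(x in X) e%:E).
Proof.
have bc (m : {measure set T -> \bar R}) (g : T -> \bar R) : measurable_fun X g ->
    (forall x, X x -> 0 <= g x) ->
    \int[m]_(x in X) g x = \sum_(k <oo) \int[m]_(x in mesh_cell k) g x.
  move=> mg g0; rewrite -[in LHS]mesh_cell_bigcup ge0_integral_bigcup//.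
  - exact: measurable_mesh_cell.
  - by rewrite mesh_cell_bigcup.
  - by rewrite mesh_cell_bigcup.
  - exact: mesh_cell_trivIset.
have fe0 i x : X x -> 0 <= (f i x + e)%:E.
  by move=> Xx; rewrite lee_fin addr_ge0 ?f0// ltW.
have i0 (m : {measure set T -> \bar R}) (g : T -> \bar R) k :
    (forall x, X x -> 0 <= g x) -> 0 <= \int[m]_(x in mesh_cell k) g x.
  by move=> g0; apply: integral_ge0 => x [Xx _]; exact: g0.
under eq_bigr => i _.
  rewrite bc; last 2 first.
    exact/measurable_EFinP.
    by move=> x Xx; rewrite lee_fin f0.
  over.
under [leRHS]eq_bigr => i _.
  rewrite bc; last 2 first.
    by apply/measurable_EFinP; apply: measurable_funD.
    exact: fe0.
  rewrite [X in _ + X]bc; last 2 first.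
    exact: measurable_cst.
    by move=> x _; rewrite lee_fin ltW.
  rewrite -nneseriesD; last 2 first.
    by move=> k _ _; apply: i0; exact: fe0.
    by move=> k _ _; apply: i0 => x _; rewrite lee_fin ltW.
  over.
rewrite -!nneseries_sum; last 2 first.
- move=> i k _; apply: adde_ge0; apply: i0; first exact: fe0.
  by move=> x _; rewrite lee_fin ltW.
- by move=> i k _; apply: i0 => x Xx; rewrite lee_fin f0.
apply: lee_nneseries => [k _ _|k _]; last exact: mesh_compare.
by apply: sume_ge0 => i _; apply: i0 => x Xx; rewrite lee_fin f0.
Qed.

End Mesh.

(** On a cell of the mesh each [f i] is within [e] of its value at a point of the
    cell, where the hypothesis applies; summing over the cells costs [e] times the
    total mass of the measures. *)
Lemma compare_integrals :
  \sum_i \int[nu i]_(x in X) (f i x)%:E <= \sum_i \int[mu i]_(x in X) (f i x)%:E.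
Proof.
pose c := (\sum_i (fine (mu i X) + fine (nu i X)))%R.
have c0 : (0 <= c)%R.
  by apply: sumr_ge0 => i _; rewrite addr_ge0// fine_ge0.
have c1 : (0 < c + 1)%R by rewrite ltr_wpDl.
apply/lee_addgt0Pr => e e0; pose h := (e / (c + 1))%R.
have h0 : (0 < h)%R by rewrite divr_gt0.
apply: le_trans (compare_integrals_mesh h0) _.
have -> : \sum_i (\int[mu i]_(x in X) (f i x + h)%:E + \int[nu i]_(x in X) h%:E) =
    \sum_i \int[mu i]_(x in X) (f i x)%:E + (h * c)%:E.
  rewrite mulr_sumr -sumEFin -big_split /=; apply: eq_bigr => i _.
  rewrite integral_cst//; under eq_integral do rewrite EFinD.
  rewrite ge0_integralD//; last 3 first.
  - by move=> x Xx; rewrite lee_fin f0.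
  - exact/measurable_EFinP.
  - by move=> x _; rewrite lee_fin ltW.
  rewrite integral_cst// mulrDr EFinD !EFinM addeA !fineK//.
  - by rewrite ge0_fin_numE.
  - by rewrite ge0_fin_numE.
rewrite leeD2l// lee_fin /h -mulrA ger_pMr// mulrC ler_pdivrMr// mul1r.
by rewrite lerDl.
Qed.

End CompareIntegrals.

Section PositivityOfMeasures.
Context (R : realType) (H : hilbertType R) (d : nat) (X : set (borelRd R d)).
Hypothesis cX : closed (X : set 'rV[R]_d).
Variable m : set (borelRd R d) -> bounded_functional H.
Hypotheses (mpos : nonneg_opmeasure X m)
  (mint : forall p : mpoly d R, opintegrable X m (poly_fun p)).

(** For [D] in [X] and [a] in [D], the difference between the two sums compared by
    [compare_integrals] is [m D] evaluated at [\sum_t t.1(a) t.2], a positive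
    operator. *)
Lemma opintegral_sum_ge0 (s : seq (mpoly d R * saop H)) :
  (forall t a, t \in s -> 0 <= poly_fun t.1 a) ->
  (forall a, X a -> psd (\sum_(t <- s) poly_fun t.1 a *: t.2)) ->
  0 <= \sum_(t <- s) opintegral X m (poly_fun t.1) t.2.
Proof.
move=> s0 spsd; have mX : measurable X by exact: Defs.closed_measurable.
have /choice[M ME] : forall A, exists mu : {measure set (borelRd R d) -> \bar R},
    psd A -> forall D, measurable D -> mu D = opmeasure_at X m A D.
  move=> A; have [pA|npA] := pselect (psd A).
    by have [mu muE] := positive_measure_measure mX (mpos pA); exists mu.
  by have [mu _] := positive_measure_measure mX (mpos (@psd0 R H)); exists mu.
pose t (i : 'I_(size s)) := tnth (in_tuple s) i.
pose f i : borelRd R d -> R := poly_fun (t i).1.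
pose mu i := M (pospart (t i).2); pose nu i := M (negpart (t i).2).
have Mint A p : psd A -> (M A).-integrable X (EFin \o poly_fun p).
  move=> pA; apply: (eq_setfun_integrable _ (mint p pA)) => D mD.
  by rewrite ME.
have MX A : psd A -> (M A X < +oo)%E.
  by move=> pA; rewrite ME// /opmeasure_at ltry.
have Mfin A p : psd A -> (\int[M A]_(x in X) (poly_fun p x)%:E)%E \is a fin_num.
  by move=> pA; apply: integrable_fin_num => //; exact: Mint.
have opE A p : psd A ->
    opintegral_psd X m (poly_fun p) A = fine (\int[M A]_(x in X) (poly_fun p x)%:E)%E.
  move=> pA; congr fine; apply: eq_setfun_integral => D mD.
  by rewrite ME.
have cmp : (\sum_i \int[nu i]_(x in X) (f i x)%:E <=
            \sum_i \int[mu i]_(x in X) (f i x)%:E)%E.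
  apply: compare_integrals => //.
  - by move=> i; apply: continuous_measurable => //; exact: poly_fun_continuous.
  - by move=> i x _; apply: s0; exact: mem_tnth.
  - by move=> i; apply: MX; exact: psd_pospart.
  - by move=> i; apply: MX; exact: psd_negpart.
  - move=> D a mD DX Da.
    have mDX A : psd A -> M A D = (m D A)%:E.
      by move=> pA; rewrite ME// /opmeasure_at setIidl.
    have nuD i : nu i D = (m D (negpart (t i).2))%:E by apply: mDX; exact: psd_negpart.
    have muD i : mu i D = (m D (pospart (t i).2))%:E by apply: mDX; exact: psd_pospart.
    under eq_bigr do rewrite nuD -EFinM.
    under [leRHS]eq_bigr do rewrite muD -EFinM.
    rewrite !sumEFin lee_fin -subr_ge0 -sumrB.
    have -> : \sum_i (f i a * m D (pospart (t i).2) - f i a * m D (negpart (t i).2)) =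
        m D (\sum_(u <- s) poly_fun u.1 a *: u.2).
      rewrite (big_tnth _ _ s) linear_sum; apply: eq_bigr => i _.
      rewrite -mulrBr -linearB -pospartB.
      have mDZ (c : R) A : m D (c *: A) = c * m D A by exact: linearZ.
      by rewrite mDZ.
    have [m0 _ _] := mpos (spsd a (DX _ Da)); exact: m0.
rewrite (big_tnth _ _ s) /opintegral.
have pE i : opintegral_psd X m (poly_fun (t i).1) (pospart (t i).2) =
    fine (\int[mu i]_(x in X) (f i x)%:E)%E by apply: opE; exact: psd_pospart.
have nE i : opintegral_psd X m (poly_fun (t i).1) (negpart (t i).2) =
    fine (\int[nu i]_(x in X) (f i x)%:E)%E by apply: opE; exact: psd_negpart.
rewrite -/t; under eq_bigr do rewrite pE nE.
rewrite sumrB subr_ge0 -lee_fin -!sumEFin.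
have nfin i : (\int[nu i]_(x in X) (f i x)%:E)%E \is a fin_num.
  by apply: Mfin; exact: psd_negpart.
have pfin i : (\int[mu i]_(x in X) (f i x)%:E)%E \is a fin_num.
  by apply: Mfin; exact: psd_pospart.
under eq_bigr do rewrite fineK//.
by under [leRHS]eq_bigr do rewrite fineK//.
Qed.

End PositivityOfMeasures.

Lemma oppoly_squares (R : realType) (H : hilbertType R) (d : nat) (F : oppoly d H) :
  exists s : seq (mpoly d R * saop H), F = \sum_(t <- s) tensor t.1 t.2 /\
    forall t, t \in s -> exists q, t.1 = q * q.
Proof.
have /choice[q qE] : forall p : mpoly d R, exists q, p = (q + 1) * (q + 1) - q * q.
  exact: poly_polarization.
exists ([seq ((q (mpolyX R k) + 1) * (q (mpolyX R k) + 1), monalg.mcoeff k F)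
          | k <- monalg.msupp F] ++
        [seq (q (mpolyX R k) * q (mpolyX R k), - monalg.mcoeff k F)
          | k <- monalg.msupp F]); split; last first.
  by move=> t; rewrite mem_cat => /orP[] /mapP[k _ ->]; eexists.
rewrite big_cat !big_map /= -big_split /= {1}(oppolyE F); apply: eq_bigr => k _.
rewrite {1}(qE (mpolyX R k)) tensorBl; congr (_ + _).
by rewrite -[- monalg.mcoeff k F]scaleN1r tensorZr scaleN1r.
Qed.

Theorem theorem3 (R : realType) (H : hilbertType R) (d : nat) (hd : (0 < d)%N)
    (X : set (borelRd R d)) (hX : closed (X : set 'rV[R]_d))
    (L : {scalar oppoly d H}) :
  (exists m : set (borelRd R d) -> bounded_functional H,
     [/\ nonneg_opmeasure X m,
         forall p : mpoly d R, opintegrable X m (poly_fun p)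
       & forall s : seq (mpoly d R * saop H),
           L (\sum_(t <- s) tensor t.1 t.2) =
           \sum_(t <- s) opintegral X m (poly_fun t.1) t.2])
  <->
  (forall F : oppoly d H,
     (forall a : 'rV[R]_d, X a -> psd (oppoly_eval F a)) -> 0 <= L F).
Proof.
split=> [[m [mpos mint mL]] F Fpos|]; last exact: measure_of_positive_functional.
have [s [FE sq]] := oppoly_squares F; rewrite FE mL.
apply: opintegral_sum_ge0 => // [t a /sq[q ->]|a Xa].
  by rewrite poly_funM -expr2 sqr_ge0.
have <- : oppoly_eval F a = \sum_(t <- s) poly_fun t.1 a *: t.2.
  rewrite FE; elim: (s) => [|t s' IH].
    by rewrite !big_nil -(scale0r 0) oppoly_evalZ scale0r.
  by rewrite !big_cons oppoly_evalD oppoly_eval_tensor IH.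
exact: Fpos.
Qed.
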